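(* \[ \limsup_{n\to\infty}\ \max_{H}\ \frac{\rho(H)}{\rho^*(H)} = \frac{3}{2}, \] where, for each $n$, the maximum is taken over all $3$-uniform, regular hypergraphs $H$ on $n$ vertices.
   Context: A hypergraph $H=(V,E)$ consists of a non-empty finite set $V=V(H)$ of vertices and a family $E=E(H)$ of subsets of $V$ called edges; all edges are non-empty and every vertex belongs to at least one edge. $H$ is $3$-uniform if $|e|=3$ for every $e\in E$. The degree of a vertex $v$ is $|\{e\in E: v\in e\}|$, and $H$ is regular if all vertices have the same degree. An edge cover in $H$ is a subfamily $E'\subseteq E$ with $\bigcup E'=V$, and $\rho(H)$ is the minimum of $|E'|$ over all edge covers $E'$. A fractional edge cover in $H$ is a function $f:E\to\mathbb{R}_+$ (non-negative reals) with $\sum_{e\ni v}f(e)\ge 1$ for every $v\in V$; its size is $|f|=\sum_{e\in E}f(e)$, and $\rho^*(H)$ is the minimum of $|f|$ over all fractional edge covers $f$. *)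

(* Defs.v *)
From mathcomp Require Import all_boot all_order all_algebra.
From mathcomp Require Import all_classical all_reals all_analysis.

Set Implicit Arguments.
Unset Strict Implicit.
Unset Printing Implicit Defensive.

Import Order.TTheory GRing.Theory Num.Theory.
Local Open Scope ring_scope.

Section Hypergraph.
Variable V : finType.
Implicit Types (E C : {set {set V}}) (v : V).

(* A hypergraph on V is given by its set of edges E; [finset.cover E] is the union of
   the members of E, so the last conjunct says that every vertex belongs to
   some edge. *)
Definition is_hypergraph E : bool :=
  [&& (0 < #|V|)%N, finset.set0 \notin E & finset.cover E == [set: V]%SET].

Definition uniform (r : nat) E : bool := [forall e in E, #|e| == r].

Definition degree E v : nat := #|[set e in E | v \in e]%SET|.

Definition regular E : bool :=
  [forall v, forall w, degree E v == degree E w].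

Definition edge_cover E C : bool := (C \subset E) && (finset.cover C == [set: V]%SET).

(* The default E of the arg min is itself an edge cover when E is a
   hypergraph. *)
Definition rho E : nat :=
  #|[arg min_(C < E | edge_cover E C) #|C|]|.

(* f is a weight on all subsets of V; its values outside E are irrelevant. *)
Definition fractional_edge_cover (R : realType) E (f : {set V} -> R) : Prop :=
  (forall e, e \in E -> 0 <= f e) /\
  (forall v, 1 <= \sum_(e in E | v \in e) f e).

(* When E is a hypergraph this is the value of a feasible linear program whose
   objective is nonnegative, so the infimum is a minimum. *)
Definition rho_star (R : realType) E : R :=
  inf [set \sum_(e in E) f e | f in @fractional_edge_cover R E]%classic.

End Hypergraph.

(* Vertex sets of size n are taken to be 'I_n, and the maximum is over a finite
   family of edge sets.  The family is empty exactly when n < 3; the maximum is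
   then -oo. *)
Definition max_cover_ratio (R : realType) (n : nat) : \bar R :=
  \big[maxe/-oo%E]_(E : {set {set 'I_n}} |
      [&& is_hypergraph E, uniform 3 E & regular E])
    ((rho E)%:R / rho_star R E)%:E.

(* Main.v *)
(* A d-regular 3-uniform hypergraph H on n vertices has rho*(H) = n/3: weigh every edge by 1/d,
   and sum the covering inequalities for the other bound. So the theorem says that rho(H) <= n/2,
   with equality infinitely often, e.g. for disjoint copies of the complete 3-graph on 4 vertices.

   For the bound, it suffices to partition the vertices into edges of H and pairs contained in
   edges of H ("shadow pairs"). By a theorem in the style of Tutte and Gallai-Edmonds, followed by
   Hall's theorem, such a partition exists unless there is a set A of vertices whose removal leaves
   more than |A| factor-critical parts K, none of which splits into one edge T of H and a perfect
   matching of K \ T by shadow pairs. Each such K has a dual certificate, an integer weighting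
   z <= 1 that is nonpositive on every edge inside K and has total at least 2 (for a singleton
   take z = 2). With the weight -2 on A, every edge of H has nonpositive weight although the total
   weight is positive, which contradicts regularity.

   Certificates come by induction on |K|. If an edge T lies inside K, then K \ T has no perfect
   matching, and Tutte's theorem gives a set B spanning an edge of the shadow graph whose removal
   leaves |B| - 1 odd parts. Take B minimal. Contracting everything outside of an odd part to an
   edge gives a smaller instance, hence a certificate of total 1 supported on that part. If there
   are two odd parts, their certificates add up; otherwise the even rest, whose complement is
   contracted to a vertex, provides the second certificate. To make this induction work one also
   needs certificates that avoid a given edge or a given vertex of K. *)

Require Import Defs.
From mathcomp Require Import all_boot all_order all_algebra zify.

Set Implicit Arguments.
Unset Strict Implicit.
Unset Printing Implicit Defensive.

Import Order.TTheory GRing.Theory Num.Theory.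

(** * Hall's theorem *)

Section Hall.
Variables (I J : finType) (r : I -> J -> bool).
Implicit Types (S : {set I}) (T : {set J}).

Definition nbrs_in T S : {set J} := [set j in T | [exists i in S, r i j]].

Lemma nbrs_inP T S j :
  reflect (j \in T /\ exists2 i, i \in S & r i j) (j \in nbrs_in T S).
Proof.
rewrite inE; apply: (iffP andP) => [[jT /existsP[i /andP[iS rij]]]|[jT [i iS rij]]].
  by split => //; exists i.
by split => //; apply/existsP; exists i; rewrite iS.
Qed.

(** Induction on [#|S|]. If a nonempty proper subset [S1] is tight, it is matched into its own
    neighbourhood and [S :\: S1] into the rest of [T]; if no subset is tight, any [i0] may take any
    of its neighbours. The element [j0] supplies a value of [g] when [S] is empty. *)
Lemma hall_in (j0 : J) T S :
  (forall S', S' \subset S -> #|S'| <= #|nbrs_in T S'|) ->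
  exists g : I -> J, {in S &, injective g} /\ forall i, i \in S -> (g i \in T) && r i (g i).
Proof.
have [n] := ubnP #|S|; elim: n S T => // n IHn S T /ltnSE-leSn hallS.
have [->|/set0Pn[i0 i0S]] := eqVneq S set0.
  by exists (fun=> j0); split=> [x y|x]; rewrite inE.
pose tight S1 := [&& S1 \subset S, S1 != set0, S1 != S & #|nbrs_in T S1| <= #|S1|].
have [/existsP[S1 /and4P[S1S S1n0 S1nS S1t]]|/existsPn notight] := boolP [exists S1, tight S1].
- have ltS1 : #|S1| < #|S| by rewrite proper_card // properEneq S1nS.
  have [g1 [g1inj g1P]] : exists g : I -> J, {in S1 &, injective g} /\
      forall i, i \in S1 -> (g i \in T) && r i (g i).
    apply: IHn => [|S' S'S1]; first exact: leq_trans ltS1 leSn.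
    by apply: hallS; apply: subset_trans S'S1 S1S.
  have [g2 [g2inj g2P]] : exists g : I -> J, {in S :\: S1 &, injective g} /\
      forall i, i \in S :\: S1 -> (g i \in T :\: nbrs_in T S1) && r i (g i).
    apply: IHn => [|S' S'S1].
      rewrite cardsD (setIidPr S1S).
      by apply: leq_trans leSn; rewrite ltn_subrL card_gt0 S1n0 (leq_ltn_trans _ ltS1).
    have dis : S' :&: S1 = set0.
      apply/setP => x; rewrite !inE; apply/negP => /andP[/(subsetP S'S1)].
      by rewrite inE => /andP[/negbTE->].
    (* Hall's condition passes to [S'] and [T] without the neighbours of [S1], because there are at
       most [#|S1|] of these. *)
    have := hallS (S' :|: S1); rewrite subUset S1S (subset_trans S'S1 (subsetDl _ _)).
    move=> /(_ isT); rewrite cardsU dis cards0 subn0 => le1.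
    have: nbrs_in T (S' :|: S1) \subset nbrs_in (T :\: nbrs_in T S1) S' :|: nbrs_in T S1.
      apply/subsetP => j /nbrs_inP[jT [i iS rij]]; rewrite inE.
      have [jN|jN] := boolP (j \in nbrs_in T S1); first by rewrite orbT.
      rewrite orbF; apply/nbrs_inP; split; first by rewrite inE jN.
      move: iS; rewrite inE => /orP[iS|iS]; first by exists i.
      by case/nbrs_inP: jN; split=> //; exists i.
    move=> /subset_leq_card le2; have le3 := leq_card_setU
      (nbrs_in (T :\: nbrs_in T S1) S') (nbrs_in T S1).
    have := leq_trans le1 (leq_trans le2 le3).
    by move=> /leq_trans /(_ (leq_add (leqnn _) S1t)); rewrite leq_add2r.
  exists (fun i => if i \in S1 then g1 i else g2 i); split.
    have cross i i' : i \in S1 -> i' \in S -> i' \notin S1 -> g1 i <> g2 i'.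
      move=> iS1 i'S i'S1 eqg; have /andP[g1T rig] := g1P i iS1.
      have := g2P i'; rewrite 2!in_setD i'S i'S1 -eqg => /(_ isT)/andP[/andP[/negP gN _] _].
      by apply: gN; apply/nbrs_inP; split => //; exists i.
    move=> i i' iS i'S; case: ifP => iS1; case: ifP => i'S1.
    + exact: g1inj.
    + by move=> /cross-[] //; rewrite i'S1.
    + by move=> /esym /cross-[] //; rewrite iS1.
    + by apply: g2inj; rewrite inE ?iS1 ?i'S1.
  move=> i iS; case: ifP => iS1; first exact: g1P.
  have := g2P i; rewrite in_setD iS1 iS => /(_ isT).
  by rewrite in_setD => /andP[/andP[_ ->] ->].
(* Without tight sets every nonempty proper subset has a neighbour to spare, so the loss of [j0'] is
   harmless. *)
- have hall1 S' : S' \subset S -> S' != set0 -> S' != S -> #|S'| < #|nbrs_in T S'|.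
    by move=> sS n0 nS; have := notight S'; rewrite /tight sS n0 nS /= -ltnNge.
  have /card_gt0P[j0' /nbrs_inP[j0T [i]]] : 0 < #|nbrs_in T [set i0]|.
    by apply: leq_trans (hallS _ _); rewrite ?sub1set // cards1.
  rewrite inE => /eqP-> {i} rij.
  have [g [ginj gP]] : exists g : I -> J, {in S :\ i0 &, injective g} /\
      forall i, i \in S :\ i0 -> (g i \in T :\ j0') && r i (g i).
    apply: IHn => [|S' S'S].
      by move: leSn; rewrite (cardsD1 i0) i0S.
    have [->|S'n0] := eqVneq S' set0; first by rewrite cards0.
    have lt : #|S'| < #|nbrs_in T S'|.
      apply: hall1 => //; first by apply: subset_trans S'S (subsetDl _ _).
      apply/eqP => eS; have := subsetP S'S i0; rewrite eS i0S !inE eqxx => /(_ isT).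
      by [].
    have : nbrs_in T S' \subset j0' |: nbrs_in (T :\ j0') S'.
      apply/subsetP => j /nbrs_inP[jT ex]; rewrite inE; have [jj|jj] := boolP (j \in [set j0']) => //=.
      by apply/nbrs_inP; split => //; rewrite inE jj.
    move=> /subset_leq_card /(leq_trans lt) /leq_trans /(_ (leq_card_setU _ _)).
    by rewrite cards1.
  exists (fun i => if i == i0 then j0' else g i); split.
    move=> i i' iS i'S; case: eqP => [->|/eqP ii]; case: eqP => [->|/eqP i'i] //.
    + by move=> eg; have := gP i'; rewrite !inE i'i i'S => /(_ isT); rewrite -eg eqxx.
    + by move=> eg; have := gP i; rewrite !inE ii iS => /(_ isT); rewrite eg eqxx.
    + by apply: ginj; rewrite !inE ?ii ?i'i.
  move=> i iS; case: eqP => [->|/eqP ii]; first by rewrite j0T.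
  by have := gP i; rewrite !inE ii iS => /(_ isT) /andP[/andP[_ ->] ->].
Qed.

Lemma hall (j0 : J) S :
  (forall S', S' \subset S -> #|S'| <= #|[set j | [exists i in S', r i j]]|) ->
  exists g : I -> J, {in S &, injective g} /\ forall i, i \in S -> r i (g i).
Proof.
move=> hallS; have [S' S'S|g [ginj gP]] := @hall_in j0 setT S.
  by apply: leq_trans (hallS _ S'S) _; apply/subset_leq_card/subsetP => j; rewrite !inE.
by exists g; split => // i /gP/andP[].
Qed.

End Hall.

(** * Perfect matchings and barriers *)

Lemma bigcup_set_ind (I T : finType) (Phi : {set T} -> Prop) (Q : {set I}) (F : I -> {set T}) :
  Phi set0 ->
  (forall X Y : {set T}, [disjoint X & Y] -> Phi X -> Phi Y -> Phi (X :|: Y)) ->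
  (forall i, i \in Q -> Phi (F i)) ->
  {in Q &, forall i j, i != j -> [disjoint F i & F j]} ->
  Phi (\bigcup_(i in Q) F i).
Proof.
move=> Phi0 PhiU; have [n] := ubnP #|Q|; elim: n Q => // n IHn Q leQ PhiF dis.
have [->|/set0Pn[i iQ]] := eqVneq Q set0; first by rewrite big_set0.
rewrite (big_setD1 i) //=; apply: PhiU; first last.
- apply: IHn => [|j /setD1P[_ jQ]|j k /setD1P[_ jQ] /setD1P[_ kQ]].
  + by move: leQ; rewrite (cardsD1 i) iQ.
  + exact: PhiF.
  + exact: dis.
- exact: PhiF.
by apply/bigcup_disjointP => j /setD1P[ji jQ]; apply: dis; rewrite // eq_sym.
Qed.

Section Matching.
Variables (V : finType) (e : rel V).
Hypotheses (e_sym : symmetric e) (e_irr : irreflexive e).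
Implicit Types (X Y K L M A : {set V}) (P Q : {set {set V}}).

(** A perfect matching of the graph induced on [X], encoded as the map that sends each vertex to its
    partner; only its values on [X] matter. *)
Definition pm X : bool :=
  [exists f : {ffun V -> V},
    [forall x in X, [&& f x \in X, e x (f x) & f (f x) == x]]].

Lemma pmP X :
  reflect (exists f : V -> V, forall x, x \in X -> [/\ f x \in X, e x (f x) & f (f x) = x])
          (pm X).
Proof.
apply: (iffP existsP) => [[f /forall_inP fP]|[f fP]].
  by exists f => x /fP/and3P[? ? /eqP].
exists [ffun x => f x]; apply/forall_inP => x /fP[fx ex ffx].
by rewrite !ffunE fx ex ffx eqxx.
Qed.

Lemma pm0 : pm set0.
Proof. by apply/pmP; exists id => x; rewrite inE. Qed.

Lemma pmU X Y : [disjoint X & Y] -> pm X -> pm Y -> pm (X :|: Y).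
Proof.
move=> dXY /pmP[f fP] /pmP[g gP]; apply/pmP.
exists (fun x => if x \in X then f x else g x) => x; rewrite inE.
have [/fP[fx ex ffx]|xX /= xY] := boolP (x \in X).
  by rewrite inE fx ffx.
have [gx ex ggx] := gP x xY; rewrite inE gx orbT ex.
by rewrite (disjointFl dXY gx).
Qed.

Lemma pm2 x y : e x y -> pm [set x; y].
Proof.
move=> exy; have nxy : x != y by apply: contraTneq exy => ->; rewrite e_irr.
apply/pmP; exists (fun z => if z == x then y else x) => z; rewrite !inE.
case/orP=> /eqP->; rewrite ?eqxx ?(eq_sym y) ?(negbTE nxy) ?eqxx ?orbT //.
by rewrite e_sym.
Qed.

Lemma pm_restrict (f : V -> V) X Y :
  (forall x, x \in X -> [/\ f x \in X, e x (f x) & f (f x) = x]) ->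
  Y \subset X -> (forall y, y \in Y -> f y \in Y) -> pm Y.
Proof.
move=> fP /subsetP YX fY; apply/pmP; exists f => y yY.
by have [_ ? ?] := fP y (YX y yY); split => //; apply: fY.
Qed.

Lemma pm_even X : pm X -> ~~ odd #|X|.
Proof.
have [n] := ubnP #|X|; elim: n X => // n IHn X leX /pmP[f fP].
have [->|/set0Pn[x xX]] := eqVneq X set0; first by rewrite cards0.
have [fxX exf ffx] := fP x xX.
have nfx : f x != x by apply: contraTneq exf => ->; rewrite e_irr.
have ce : #|X| = #|X :\ x :\ f x|.+2.
  by rewrite (cardsD1 x X) xX (cardsD1 (f x) (X :\ x)) !inE nfx fxX.
rewrite ce /= negbK; apply: IHn; first by rewrite ce in leX; lia.
apply: (pm_restrict fP); first by rewrite !subDset; apply/subsetP => y; rewrite !inE => ->; rewrite !orbT.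
move=> y; rewrite !inE => /and3P[yf yx yX]; have [fyX _ ffy] := fP y yX.
rewrite fyX andbT; apply/andP; split.
  by apply: contraNneq yx => eq1; rewrite -ffy eq1 ffx.
by apply: contraNneq yf => eq1; rewrite -ffy eq1.
Qed.

(** The empty set satisfies this vacuously, hence the hypothesis [K != set0] where oddness is
    derived. *)
Definition factor_critical K := [forall v in K, pm (K :\ v)].

Lemma factor_criticalP K : reflect (forall v, v \in K -> pm (K :\ v)) (factor_critical K).
Proof. exact: forall_inP. Qed.

Lemma factor_critical_odd K : K != set0 -> factor_critical K -> odd #|K|.
Proof.
case/set0Pn=> v vK /factor_criticalP/(_ v vK)/pm_even.
by rewrite (cardsD1 v K) vK.
Qed.

Definition touches L a := [exists x in L, e x a].

Lemma touchesP L a : reflect (exists2 x, x \in L & e x a) (touches L a).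
Proof. exact: exists_inP. Qed.

(** Pair [a] with a neighbour [x] in [L]; criticality matches the rest of [L]. *)
Lemma pm_attach L a : factor_critical L -> a \notin L -> touches L a -> pm (a |: L).
Proof.
move=> /factor_criticalP Lfc aL /touchesP[x xL exa].
have -> : a |: L = [set x; a] :|: (L :\ x).
  apply/setP => y; rewrite !inE; have [->|_] := eqVneq y x; first by rewrite xL orbT.
  by [].
apply: pmU; [|exact: pm2|exact: Lfc].
rewrite -setI_eq0; apply/eqP/setP => y; rewrite !inE.
have [->|_] //= := eqVneq y x; have [->|_] //= := eqVneq y a.
exact: negbTE.
Qed.

(** Each part together with its own representative [g L] is matched by [pm_attach], and these
    enlarged parts are disjoint. *)
Lemma pm_parts Q (g : {set V} -> V) :
  trivIset Q -> {in Q, forall L, factor_critical L} ->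
  {in Q, forall L, touches L (g L) && (g L \notin cover Q)} -> {in Q &, injective g} ->
  pm (cover Q :|: g @: Q).
Proof.
move=> /trivIsetP tQ fcQ gQ ginj.
have -> : cover Q :|: g @: Q = \bigcup_(L in Q) (g L |: L).
  apply/setP => x; rewrite inE; apply/idP/bigcupP => [/orP[/bigcupP[L LQ xL]|/imsetP[L LQ ->]]|[L LQ]].
  - by exists L => //; rewrite inE xL orbT.
  - by exists L => //; rewrite setU11.
  - case/setU1P => [->|xL]; first by rewrite imset_f ?orbT.
    by apply/orP; left; apply/bigcupP; exists L.
have out L M : L \in Q -> M \in Q -> g L \notin M.
  move=> /gQ/andP[_ gL] MQ; apply: contra gL => gM; apply/bigcupP; by exists M.
apply: (@bigcup_set_ind _ _ pm) => [|X Y|L LQ|L M LQ MQ LM]; first exact: pm0.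
- exact: pmU.
- by have /andP[tL _] := gQ L LQ; apply: pm_attach => //; [apply: fcQ|apply: out].
rewrite -setI_eq0; apply/eqP/setP => x; rewrite !inE.
apply/negP => /andP[/orP[/eqP->|xL] /orP[|xM]].
- by move/eqP/ginj => /(_ LQ MQ) eLM; rewrite eLM eqxx in LM.
- by have := out L M LQ MQ; rewrite xM.
- by move/eqP=> ex; have := out M L MQ LQ; rewrite -ex xL.
- by have := disjointFr (tQ L M LQ MQ LM) xL; rewrite xM.
Qed.

(** * Barriers and a decomposition in the style of Gallai and Edmonds *)

Definition separated P :=
  [forall L in P, forall M in P, (L != M) ==> [forall x in L, forall y in M, ~~ e x y]].

Lemma separatedP P :
  reflect (forall L M x y, L \in P -> M \in P -> L != M -> x \in L -> y \in M -> ~~ e x y)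
          (separated P).
Proof.
apply: (iffP forall_inP) => [sP L M x y LP MP LM xL yM|sP L LP].
  have /forall_inP/(_ M MP)/implyP/(_ LM)/forall_inP/(_ x xL)/forall_inP/(_ y yM) := sP L LP.
  by [].
apply/forall_inP => M MP; apply/implyP => LM; apply/forall_inP => x xL.
by apply/forall_inP => y yM; apply: (sP L M).
Qed.

Definition odd_parts P := #|[set L in P | odd #|L|]|.

Lemma odd_card_partition P X : partition P X -> odd #|X| = odd (odd_parts P).
Proof.
move=> pP; rewrite (card_partition pP) /odd_parts -sum1_card.
have -> : \sum_(L in [set L in P | odd #|L|]) 1 = \sum_(L in P | odd #|L|) 1.
  by apply: eq_bigl => L; rewrite inE.
rewrite (bigID (fun L : {set V} => odd #|L|)) /= oddD.
have e1 (S : pred {set V}) : {in S, forall L, odd #|L|} ->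
    odd (\sum_(L | S L) #|L|) = odd (\sum_(L | S L) 1).
  move=> oS; apply: (big_rec2 (fun a b => odd a = odd b)) => // L a b SL ab.
  by rewrite !oddD ab oS.
rewrite e1; last by move=> L; rewrite unfold_in => /andP[].
suff -> : odd (\sum_(i in P | ~~ odd #|i|) #|i|) = false by rewrite addbF.
apply: (big_rec (fun a => odd a = false)) => // L a /andP[_ oL] oa.
by rewrite oddD oa (negbTE oL).
Qed.

Section Barrier.
Variable X : {set V}.

(** The parts are unions of components of [X :\: A], not necessarily single ones, so that they can
    be merged and refined freely. *)
Definition barrier A P := [&& A \subset X, partition P (X :\: A) & separated P].

(** The new parts lie in [L], so they inherit its separation from the other parts. The count is
    stated without subtraction: [L] leaves the family and takes its contribution [odd #|L|] with
    it. *)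
Lemma barrier_refine A P L A1 P1 :
  barrier A P -> L \in P -> A1 \subset L -> partition P1 (L :\: A1) -> separated P1 ->
  barrier (A :|: A1) ((P :\ L) :|: P1) /\
  odd_parts ((P :\ L) :|: P1) + odd #|L| = odd_parts P + odd_parts P1.
Proof.
move=> /and3P[AX pP sP] LP A1L pP1 sP1.
have LX : L \subset X :\: A := partitionS pP LP.
have P1L M : M \in P1 -> M \subset L.
  by move=> MP1; apply: subset_trans (partitionS pP1 MP1) (subsetDl _ _).
have P1n M : M \in P1 -> M != set0 by apply: partition_neq0 pP1.
have dis : [disjoint P :\ L & P1].
  rewrite -setI_eq0; apply/eqP/setP => M; rewrite !inE; apply/negP => /andP[/andP[ML MP] MP1].
  have /set0Pn[x xM] := P1n M MP1.
  have /trivIsetP/(_ M L MP LP ML) := partition_trivIset pP.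
  by move/disjointFr/(_ xM); rewrite (subsetP (P1L M MP1) x xM).
split.
  apply/and3P; split.
  - rewrite subUset AX; apply: subset_trans A1L _; apply: subset_trans LX (subsetDl _ _).
  - apply/and3P; split.
    + have -> : cover (P :\ L :|: P1) = cover (P :\ L) :|: cover P1.
        by rewrite /cover bigcup_setU.
      rewrite (coverD1 (partition_trivIset pP) LP) (cover_partition pP) (cover_partition pP1).
      apply/eqP/setP => x; rewrite !inE.
      have := subsetP LX x; have := subsetP A1L x; rewrite inE.
      by case: (x \in L); case: (x \in A1); case: (x \in A); case: (x \in X) => // h1 h2;
        try (by have := h1 isT); try (by have := h2 isT).
    + apply: trivIsetU; [exact: trivIsetD (partition_trivIset pP)|exact: partition_trivIset pP1|].
      rewrite (coverD1 (partition_trivIset pP) LP) (cover_partition pP1) -setI_eq0.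
      by apply/eqP/setP => x; rewrite !inE; case: (x \in L); rewrite // !andbF.
    + rewrite !inE (partition0 pP) (partition0 pP1) andbF //.
  - apply/separatedP => M N x y; rewrite !inE => /orP[/andP[ML MP]|MP1] /orP[/andP[NL NP]|NP1] MN xM yN.
    + exact: (separatedP P sP M N).
    + by apply: (separatedP P sP M L) => //; apply: (subsetP (P1L N NP1)).
    + by apply: (separatedP P sP L N); rewrite // 1?eq_sym //; apply: (subsetP (P1L M MP1)).
    + exact: (separatedP P1 sP1 M N).
rewrite /odd_parts.
have -> : [set M in P :\ L :|: P1 | odd #|M|] =
          [set M in P :\ L | odd #|M|] :|: [set M in P1 | odd #|M|].
  by apply/setP => M; rewrite !inE; case: (odd _); rewrite ?andbT ?andbF.
rewrite cardsU (_ : _ :&: _ = set0) ?cards0 ?subn0; last first.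
  apply/setP => M; rewrite !inE; apply/negP => /andP[/andP[/andP[ML MP] _] /andP[MP1 _]].
  have := disjointFl dis MP1; by rewrite !inE ML MP.
rewrite (cardsD1 L [set M in P | odd #|M|]) inE LP /=.
have -> : [set M in P | odd #|M|] :\ L = [set M in P :\ L | odd #|M|].
  by apply/setP => M; rewrite !inE andbA.
by rewrite addnC addnA.
Qed.

(** When [A'] leaves the barrier, it is fused with all the parts it touches; the remaining parts see
    neither [A'] nor the parts in [N]. *)
Lemma barrier_merge A P A' N :
  barrier A P -> A' \subset A -> A' != set0 ->
  N = nbrs_in (fun a L => touches L a) P A' ->
  barrier (A :\: A') ((A' :|: cover N) |: (P :\: N)).
Proof.
move=> /and3P[AX pP sP] A'A A'n defN.
have tP := partition_trivIset pP; have cP := cover_partition pP.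
have NP : N \subset P by rewrite defN; apply/subsetP => L /nbrs_inP[].
have cN : cover N \subset X :\: A.
  by rewrite -cP; apply/bigcupsP => L LN; apply: bigcup_sup; apply: (subsetP NP).
have cPN : cover (P :\: N) = (X :\: A) :\: cover N.
  apply/setP => x; rewrite inE -cP; apply/bigcupP/andP => [[L /setDP[LP LN] xL]|[xN /bigcupP[L LP xL]]].
    split; last by apply/bigcupP; exists L.
    apply/negP => /bigcupP[M MN xM].
    have /trivIsetP/(_ L M LP (subsetP NP M MN)) := tP.
    have LM : L != M by apply: contraNneq LN => ->.
    by move=> /(_ LM)/disjointFr/(_ xL); rewrite xM.
  exists L => //; rewrite inE LP andbT; apply: contra xN => LN; apply/bigcupP; by exists L.
have WX : [disjoint A' :|: cover N & X :\: A :\: cover N].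
  rewrite -setI_eq0; apply/eqP/setP => x; rewrite !inE; have := subsetP A'A x.
  by case: (x \in A'); case: (x \in cover N); case: (x \in A); rewrite ?andbF //= => /(_ isT).
have pPN : partition (P :\: N) (X :\: A :\: cover N).
  apply/and3P; split; rewrite ?cPN ?eqxx ?trivIsetD //.
  by rewrite inE (partition0 pP) andbF.
have Wn : A' :|: cover N != set0.
  by case/set0Pn: A'n => a aA'; apply/set0Pn; exists a; rewrite inE aA'.
apply/and3P; split.
- exact: subset_trans (subsetDl _ _) AX.
- have -> : X :\: (A :\: A') = (A' :|: cover N) :|: (X :\: A :\: cover N).
    apply/setP => x; rewrite !inE; have := subsetP A'A x; have := subsetP cN x; have := subsetP AX x.
    rewrite inE.
    by case: (x \in A'); case: (x \in cover N); case: (x \in A); case: (x \in X) => //= h1 h2 h3;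
      try (by have := h1 isT); try (by have := h2 isT); try (by have := h3 isT).
  exact: partitionU1.
- have sepW L x y : L \in P :\: N -> x \in A' :|: cover N -> y \in L -> ~~ e x y.
    move=> /setDP[LP LN] /setUP[xA'|/bigcupP[M MN xM]] yL.
      apply: contra LN => exy; rewrite defN; apply/nbrs_inP; split => //; exists x => //.
      by apply/touchesP; exists y; rewrite // e_sym.
    apply: (separatedP P sP M L) => //; first exact: (subsetP NP).
    by apply: contraNneq LN => <-.
  apply/separatedP => L M x y; rewrite 2!in_setU1 => /orP[/eqP->|LP] /orP[/eqP->|MP] LM xL yM.
  + by rewrite eqxx in LM.
  + exact: sepW MP xL yM.
  + by rewrite e_sym; exact: sepW LP yM xL.
  + by apply: (separatedP P sP L M) => //; [case/setDP: LP|case/setDP: MP].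
Qed.

End Barrier.
(** Hall's theorem injects [A] into the touched parts. Since [#|P| <= #|A|], this is a bijection,
    and its inverse gives every part its own vertex of [A]. *)
Lemma pm_barrier X A P :
  barrier X A P -> {in P, forall L, factor_critical L} ->
  (forall A', A' \subset A -> #|A'| <= #|nbrs_in (fun a L => touches L a) P A'|) ->
  #|P| <= #|A| -> pm X.
Proof.
move=> /and3P[AX pP _] fcP hallA lePA.
have [g [ginj gP]] := @hall_in _ _ (fun a L => touches L a) set0 P A hallA.
have gA : g @: A = P.
  apply/eqP; rewrite eqEcard card_in_imset // lePA andbT.
  by apply/subsetP => _ /imsetP[a aA ->]; have /andP[] := gP a aA.
have [P0|/set0Pn[L0 L0P]] := eqVneq P set0.
  have := card_in_imset ginj; rewrite gA P0 cards0 => /esym/cards0_eq A0.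
  have := cover_partition pP; rewrite P0 A0 /cover big_set0 setD0 => <-; exact: pm0.
have /imsetP[a0 _ _] : L0 \in g @: A by rewrite gA.
pose h L := odflt a0 [pick a in A | g a == L].
have hP L : L \in P -> h L \in A /\ g (h L) = L.
  rewrite -gA => /imsetP[a aA ->]; rewrite /h; case: pickP => [b /andP[bA /eqP]|/(_ a)] //=.
  by rewrite aA eqxx.
have hinj : {in P &, injective h} by move=> L M /hP[_ eL] /hP[_ eM] eqh; rewrite -eL -eM eqh.
have hA : h @: P = A.
  apply/eqP; rewrite eqEcard (card_in_imset hinj) -gA card_in_imset // leqnn andbT.
  by apply/subsetP => _ /imsetP[L LP ->]; rewrite gA in LP; have [] := hP L LP.
have -> : X = cover P :|: h @: P.
  rewrite hA (cover_partition pP); apply/setP => x; rewrite !inE.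
  by have := subsetP AX x; case: (x \in A); case: (x \in X) => // /(_ isT).
apply: pm_parts => //; first exact: partition_trivIset pP.
move=> L LP; have [hLA eL] := hP L LP.
by rewrite (cover_partition pP) inE hLA andbT; have /andP[_] := gP _ hLA; rewrite eL.
Qed.

Lemma separated1 L : separated [set L].
Proof.
by apply/separatedP => M N x y; rewrite !inE => /eqP-> /eqP->; rewrite eqxx.
Qed.

(* Take [A] with the largest excess of odd parts over [#|A|], and of largest size among those. *)
Lemma tutte_strong X :
  exists A P, [/\ barrier X A P, {in P, forall L, factor_critical L} &
    forall A', A' \subset A -> #|A'| <= #|nbrs_in (fun a L => touches L a) P A'|].
Proof.
have [n] := ubnP #|X|; elim: n X => // n IHn X leX.
(* The lexicographic order packed into one number: [#|A|] is a digit in base [#|X|.+1], and adding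
   [#|X|] keeps the excess from being truncated at zero. *)
pose val (p : {set V} * {set {set V}}) :=
  (odd_parts p.2 + (#|X| - #|p.1|)) * #|X|.+1 + #|p.1|.
have ok0 : barrier X (X, set0 : {set {set V}}).1 (X, set0 : {set {set V}}).2.
  apply/and3P; split; rewrite /= ?subxx ?setDv ?partition_set0 //.
  by apply/separatedP => L M x y; rewrite inE.
case: (@arg_maxnP _ (X, set0) (fun p => barrier X p.1 p.2) val ok0) => -[A P] /= bAP maxAP.
have AX : A \subset X by case/and3P: bAP.
have pP : partition P (X :\: A) by case/and3P: bAP.
have maxi A' P' : barrier X A' P' -> odd_parts P' + #|A| <= odd_parts P + #|A'| /\
    (odd_parts P + #|A'| <= odd_parts P' + #|A| -> #|A'| <= #|A|).
  move=> b'; have := maxAP (A', P') b'; rewrite /val /=.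
  have leA' : #|A'| <= #|X| by apply: subset_leq_card; case/and3P: b'.
  have leA := subset_leq_card AX.
  move: (odd_parts P) (odd_parts P') #|A| #|A'| #|X| leA leA' => o o' a a' x lea lea' le1.
  have le2 : o' + (x - a') <= o + (x - a).
    rewrite leqNgt; apply/negP => lt; have := leq_mul lt (leqnn x.+1).
    by rewrite mulSn; lia.
  split; first by lia.
  move=> le3; have e1 : o' + (x - a') = o + (x - a) by lia.
  by move: le1; rewrite e1; lia.
have refine L A1 P1 : L \in P -> A1 \subset L -> partition P1 (L :\: A1) -> separated P1 ->
    odd_parts P1 + #|A| <= odd #|L| + #|A :|: A1| /\
    (odd #|L| + #|A :|: A1| <= odd_parts P1 + #|A| -> #|A :|: A1| <= #|A|).
  move=> LP A1L pP1 sP1; have [b' eo] := barrier_refine bAP LP A1L pP1 sP1.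
  by have := maxi _ _ b'; move: eo; clear; lia.
have cardAU L A1 : L \in P -> A1 \subset L -> #|A :|: A1| = #|A| + #|A1|.
  move=> LP A1L; rewrite cardsU (_ : A :&: A1 = set0) ?cards0 ?subn0 //.
  apply/setP => x; rewrite !inE; apply/negP => /andP[xA /(subsetP A1L)].
  by move/(subsetP (partitionS pP LP)); rewrite inE xA.
(* An even part could hand a vertex [v] to [A]: the odd set [L :\ v] preserves the excess while [A]
   grows. *)
have oddP L : L \in P -> odd #|L|.
  move=> LP; apply/negPn/negP => evL.
  have /set0Pn[v vL] := partition_neq0 pP LP.
  have cL : #|L| = #|L :\ v|.+1 by rewrite (cardsD1 v L) vL.
  have vL1 : [set v] \subset L by rewrite sub1set.
  have oL : odd #|L :\ v| by move: evL; rewrite cL /= negbK.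
  have pL : partition [set L :\ v] (L :\: [set v]).
    apply/and3P; split; rewrite ?cover1 ?eqxx ?trivIset1 // inE eq_sym.
    by apply: contraTneq oL => ->; rewrite cards0.
  have [_] := refine L _ _ LP vL1 pL (separated1 _).
  have -> : odd_parts [set L :\ v] = 1.
    rewrite /odd_parts (_ : [set _ in _ | _] = [set L :\ v]) ?cards1 //.
    by apply/setP => M; rewrite !inE; case: eqP => // ->; rewrite oL.
  by rewrite (cardAU L) // cards1 (negbTE evL); clear; lia.
exists A, P; split=> // [L LP|A' A'A].
  (* If [L :\ v] has no perfect matching, induction gives a barrier [A1] of it with more than
     [#|A1|] odd parts, hence by parity with at least [#|A1| + 2]. Moving [v |: A1] into [A] does
     not lower the excess and enlarges [A], a contradiction. *)
  apply/factor_criticalP => v vL; case: (boolP (pm (L :\ v))) => // npm.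
  have cL : #|L| = #|L :\ v|.+1 by rewrite (cardsD1 v L) vL.
  have leL : #|L| <= #|X|.
    by apply/subset_leq_card/(subset_trans (partitionS pP LP)); exact: subsetDl.
  have [|A1 [P1 [b1 fc1 hall1]]] := IHn (L :\ v); first by move: cL leL leX; clear; lia.
  have ltA1 : #|A1| < #|P1|.
    by rewrite ltnNge; apply: contra npm => leP1; exact: (pm_barrier b1 fc1 hall1).
  have /and3P[A1L pP1 sP1] := b1.
  have oP1 M : M \in P1 -> odd #|M|.
    by move=> MP1; apply: factor_critical_odd (fc1 _ MP1); apply: partition_neq0 pP1 MP1.
  have eP1 : odd_parts P1 = #|P1|.
    by apply: eq_card => M; rewrite inE; have := oP1 M; case: (M \in P1) => // ->.
  have cLv : #|L :\ v| = #|A1| + #|(L :\ v) :\: A1|.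
    by rewrite -(cardsID A1 (L :\ v)) (setIidPr A1L).
  have := odd_card_partition pP1; rewrite eP1 => par.
  have evL : ~~ odd #|L :\ v| by have := oddP L LP; rewrite cL.
  have vA1 : v \notin A1 by apply: contraTN isT => /(subsetP A1L); rewrite !inE eqxx.
  have A1L' : v |: A1 \subset L by rewrite subUset sub1set vL (subset_trans A1L (subsetDl _ _)).
  have pP1' : partition P1 (L :\: (v |: A1)).
    by rewrite -(_ : L :\ v :\: A1 = L :\: (v |: A1)) // setDDl.
  have [_] := refine L _ _ LP A1L' pP1' sP1.
  by rewrite (cardAU L) // cardsU1 vA1 (oddP L LP) eP1; move: ltA1 par evL cLv; clear; lia.
have [->|A'n] := eqVneq A' set0; first by rewrite cards0.
set N := nbrs_in _ _ _.
(* The merge costs at most [#|N|] odd parts and frees [#|A'|] barrier vertices, so maximality of the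
   excess forces [#|A'| <= #|N|]. *)
have [] := maxi _ _ (barrier_merge bAP A'A A'n (erefl N)); move=> le1 _.
have eP : odd_parts P = #|P|.
  by apply: eq_card => M; rewrite inE; have := oddP M; case: (M \in P) => // ->.
have NP : N \subset P by apply/subsetP => L /nbrs_inP[].
have le2 : #|P :\: N| <= odd_parts ((A' :|: cover N) |: (P :\: N)).
  apply: subset_leq_card; apply/subsetP => L LPN; rewrite inE in_setU1 LPN orbT.
  by apply: oddP; case/setDP: LPN.
have := subset_leq_card A'A; have := subset_leq_card NP.
have arith (o p a a' k : nat) : o + a <= p + (a - a') -> p - k <= o -> k <= p -> a' <= a -> a' <= k.
  by clear; lia.
by move: le1 le2; rewrite !cardsD (setIidPr NP) (setIidPr A'A) eP; apply: arith.
Qed.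

End Matching.

(** * Certificates *)

Section Weights.
Variable V : finType.
Implicit Types (z : V -> int) (X Y S T : {set V}) (F : {set {set V}}).

Definition weight z X : int := (\sum_(v in X) z v)%R.

Lemma weight0 z : weight z set0 = 0%R.
Proof. by rewrite /weight big_set0. Qed.

Lemma weight1 z x : weight z [set x] = z x.
Proof. by rewrite /weight big_set1. Qed.

Lemma weightD z1 z2 X : weight (fun v => z1 v + z2 v)%R X = (weight z1 X + weight z2 X)%R.
Proof. exact: big_split. Qed.

Lemma eq_weight z1 z2 X : {in X, z1 =1 z2} -> weight z1 X = weight z2 X.
Proof. by move=> e12; apply: eq_bigr. Qed.

Lemma weightID z X Y : weight z X = (weight z (X :&: Y) + weight z (X :\: Y))%R.
Proof. exact: big_setID. Qed.

Lemma weight_eq0 z X : {in X, forall v, z v = 0%R} -> weight z X = 0%R.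
Proof. exact: big1. Qed.

Lemma weight_supp z S X : (forall v, v \notin S -> z v = 0%R) -> weight z X = weight z (X :&: S).
Proof.
move=> zS; rewrite (weightID z X S) [X in (_ + X)%R]weight_eq0 ?addr0 // => v.
by rewrite inE => /andP[/zS].
Qed.

Lemma weight_set1U z x X : x \notin X -> weight z (x |: X) = (z x + weight z X)%R.
Proof. by move=> xX; rewrite /weight big_setU1. Qed.

(* By LP duality, a nonnegative weighting of [F] with all degrees at most 1 then has total
   deficiency at least [k] at the vertices of [S]. *)
Definition certificate z F S (k : int) :=
  [/\ forall v, (z v <= 1)%R, forall v, v \notin S -> z v = 0%R,
      forall T, T \in F -> (weight z T <= 0)%R & (k <= weight z S)%R].

Lemma certificateW z F S S' k :
  S \subset S' -> certificate z F S k -> certificate z F S' k.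
Proof.
move=> SS' [z1 z0 zF zk]; split=> // [v vS'|].
  by apply: z0; apply: contra vS'; apply: (subsetP SS').
by rewrite (weight_supp _ z0) (setIidPr SS').
Qed.

(** Disjointness of the supports preserves the upper bound 1; all other conditions add up. *)
Lemma certificateU z1 z2 F S1 S2 k1 k2 :
  [disjoint S1 & S2] -> certificate z1 F S1 k1 -> certificate z2 F S2 k2 ->
  certificate (fun v => z1 v + z2 v)%R F (S1 :|: S2) (k1 + k2)%R.
Proof.
move=> dS [le1 s1 F1 w1] [le2 s2 F2 w2]; split => [v|v|T TF|].
- have [vS1|/s1->] := boolP (v \in S1); last by rewrite add0r.
  by rewrite (s2 v) ?addr0 // (disjointFr dS vS1).
- by rewrite inE negb_or => /andP[/s1-> /s2->]; rewrite addr0.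
- by rewrite weightD; have := F1 T TF; have := F2 T TF; lia.
- rewrite weightD (weight_supp _ s1) (weight_supp (S := S2) _ s2).
  by rewrite (setIidPr (subsetUl _ _)) (setIidPr (subsetUr _ _)); lia.
Qed.

End Weights.

Lemma pm_sub_rel (V : finType) (e1 e2 : rel V) (X : {set V}) :
  {in X &, forall x y, e1 x y -> e2 x y} -> pm e1 X -> pm e2 X.
Proof.
move=> e12 /pmP[f fP]; apply/pmP; exists f => x xX.
by have [fx ex ffx] := fP x xX; split => //; apply: e12.
Qed.

(** * Extending perfect matchings by an edge or by a matched subset *)

Section Lobes.
Variables (V : finType) (e : rel V).
Hypotheses (e_sym : symmetric e) (e_irr : irreflexive e).
Implicit Types (X Y K L S T : {set V}).

Lemma pm_pair X x y :
  x \in X -> y \in X -> e x y -> pm e (X :\ x :\ y) -> pm e X.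
Proof.
move=> xX yX exy pmX; have -> : X = [set x; y] :|: (X :\ x :\ y).
  apply/setP => v; rewrite !inE.
  have [->|_] := eqVneq v x; first by rewrite xX.
  by have [->|_] := eqVneq v y; first by rewrite yX.
apply: pmU => //; last exact: pm2.
by rewrite -setI_eq0; apply/eqP/setP => v; rewrite !inE; case: eqP => //=; case: eqP.
Qed.

Lemma pm_cut X Y : Y \subset X -> pm e Y -> pm e (X :\: Y) -> pm e X.
Proof.
move=> YX pY pXY; rewrite -(setID X Y) (setIidPr YX); apply: pmU => //.
by rewrite -setI_eq0; apply/eqP/setP => v; rewrite !inE; case: (v \in Y); rewrite ?andbF.
Qed.

End Lobes.

(** * The statements of the induction *)

Section Claims.
Variables (V : finType) (e : rel V) (F : {set {set V}}) (K : {set V}).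

(** Models the edges of a hypergraph inside a set that cannot be packed. The graph [e] is kept
    separate from [F], since contraction creates adjacent pairs that lie in no member of the new
    family. *)
Definition obstructed :=
  forall T, T \in F ->
    [/\ T \subset K, #|T| = 3, {in T &, forall x y, x != y -> e x y} & ~~ pm e (K :\: T)].

(** In the application [x] and [y] are the two vertices that replace the surroundings of a part, so
    the certificate lives on the part itself. *)
Definition edge_claim :=
  forall x y, x \in K -> y \in K -> e x y ->
    exists z, certificate z F (K :\: [set x; y]) 1.

(** In the application [u] replaces the surroundings of the even rest. A total of 2 leaves one unit
    to spend as weight -1 on a vertex of the barrier; with a total of 1 nothing is to spare, so
    neighbours of [u] must not have positive weight. *)
Definition vertex_claim :=
  forall u, u \in K -> exists z, certificate z F (K :\ u) 2 \/
    (certificate z F (K :\ u) 1 /\ forall v, v \in K -> e u v -> (z v <= 0)%R).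

Definition total_claim := exists z, certificate z F K 2.

End Claims.

(** * Lobes *)

Lemma subset_implyb (T : finType) (X Y : {set T}) v : X \subset Y -> (v \in X) ==> (v \in Y).
Proof. by move=> /subsetP sXY; apply/implyP/sXY. Qed.

Section OddLobe.
Variables (V : finType) (e : rel V).
Hypotheses (e_sym : symmetric e) (e_irr : irreflexive e).
Variables (F : {set {set V}}) (K : {set V}).
Hypothesis obsF : obstructed e F K.

(* Contract [B1] and [B :\: B1] to two adjacent vertices [c1] and [c2], and discard the rest. *)
Lemma odd_lobe (K1 B B1 : {set V}) :
  K1 \subset K -> B \subset K -> [disjoint K1 & B] -> K1 != set0 -> factor_critical e K1 ->
  (forall x y, x \in K1 -> y \in K -> e x y -> y \in K1 :|: B) ->
  B1 \subset B -> (exists2 b, b \in B1 & touches e K1 b) ->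
  (exists2 b, b \in B :\: B1 & touches e K1 b) ->
  (forall b1 b2, b1 \in B1 -> b2 \in B :\: B1 -> pm e (K :\: K1 :\ b1 :\ b2)) ->
  (forall b b', b \in B -> b' \in B -> e b b' -> pm e (K :\: K1 :\ b :\ b')) ->
  (exists b b', [/\ b \in B, b' \in B & e b b']) ->
  #|K1|.+2 < #|K| ->
  (forall (e' : rel V) (F' : {set {set V}}) (K' : {set V}), symmetric e' -> irreflexive e' -> #|K'| < #|K| -> 1 < #|K'| ->
     factor_critical e' K' -> obstructed e' F' K' -> edge_claim e' F' K') ->
  exists z, certificate z F K1 1.
Proof.
move=> K1K BK dKB K1n fcK1 nbrK1 B1B [c1 c1B1 tc1] [c2 c2B2 tc2] pm12 pmadj [a [a' [aB a'B eaa']]] ltK IH.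
have K1F v : v \in B -> (v \in K1) = false by apply: disjointFl.
have c1B := subsetP B1B c1 c1B1.
have [c2B c2B1] : c2 \in B /\ c2 \notin B1 by case/setDP: c2B2.
have c12 : c1 != c2 by apply: contraNneq c2B1 => <-.
pose t1 x := [exists b in B1, e x b].
pose t2 x := [exists b in B :\: B1, e x b].
(* The contracted graph: unchanged on [K1], with [c1] standing for [B1] and [c2] for [B :\: B1],
   each adjacent to the vertices of [K1] that have a neighbour in its class, and adjacent to each
   other. *)
pose e0 x y := if x \in K1 then
    if y \in K1 then e x y else if y == c1 then t1 x else (y == c2) && t2 x
  else if y \in K1 then if x == c1 then t1 y else (x == c2) && t2 y
  else [&& x != y, x \in [set c1; c2] & y \in [set c1; c2]].
have e0sym : symmetric e0.
  by move=> x y; rewrite /e0; case: (x \in K1); case: (y \in K1); rewrite // eq_sym; case: (_ != _) => //=; rewrite andbC.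
have e0irr : irreflexive e0 by move=> x; rewrite /e0; case: (x \in K1); rewrite ?e_irr ?eqxx.
have e0K1 x y : x \in K1 -> y \in K1 -> e0 x y = e x y by rewrite /e0 => -> ->.
have e0c1 x : x \in K1 -> e0 x c1 = t1 x by rewrite /e0 => ->; rewrite K1F // eqxx.
have e0c2 x : x \in K1 -> e0 x c2 = t2 x.
  by rewrite /e0 => ->; rewrite K1F // eqxx eq_sym (negbTE c12).
have e0cc : e0 c1 c2 by rewrite /e0 !K1F // c12 !inE !eqxx orbT.
have pmK1 (X : {set V}) : X \subset K1 -> pm e0 X = pm e X.
  move=> /subsetP XK; apply/idP/idP; apply: pm_sub_rel => x y xX yX; by rewrite e0K1 ?XK.
pose K' := c1 |: (c2 |: K1).
have cK' : #|K'| = #|K1|.+2.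
  by rewrite /K' !cardsU1 !inE (negbTE c12) !K1F.
have K1K' : K1 \subset K' by rewrite /K' setUA subsetUr.
have fc0K1 : factor_critical e0 K1.
  apply/factor_criticalP => v vK1; rewrite pmK1 ?subsetDl //.
  exact: (factor_criticalP _ _ fcK1).
have tc1' : touches e0 K1 c1.
  case/touchesP: tc1 => x xK1 exc; apply/touchesP; exists x => //; rewrite e0c1 //.
  by apply/exists_inP; exists c1.
have tc2' : touches e0 K1 c2.
  case/touchesP: tc2 => x xK1 exc; apply/touchesP; exists x => //; rewrite e0c2 //.
  by apply/exists_inP; exists c2.
(* Without [c1] or [c2], the other one is attached to [K1]; without a vertex of [K1], the pair [c1],
   [c2] is matched. *)
have fcK' : factor_critical e0 K'.
  apply/factor_criticalP => v; rewrite !in_setU1.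
  have [->|vc1] := eqVneq v c1 => [_|/=].
    rewrite (_ : K' :\ c1 = c2 |: K1); first by apply: pm_attach => //; rewrite K1F.
    by rewrite /K' setU1K // !inE (negbTE c12) K1F.
  have [->|vc2 /= vK1] := eqVneq v c2 => [_|].
    rewrite (_ : K' :\ c2 = c1 |: K1); first by apply: pm_attach => //; rewrite K1F.
    rewrite /K' setUCA setU1K // !inE eq_sym (negbTE c12) K1F //.
  have c1v : c1 \in K' :\ v by rewrite !inE eq_sym vc1 eqxx.
  have c2v : c2 \in K' :\ v by rewrite !inE eq_sym vc2 eqxx orbT.
  apply: (pm_pair e0sym e0irr c1v c2v e0cc).
  rewrite (_ : _ :\ c2 = K1 :\ v).
    exact: (factor_criticalP _ _ fc0K1).
  apply/setP => x; rewrite !inE.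
  have [->|_] := eqVneq x c2; first by rewrite K1F //= andbF.
  by have [->|_] := eqVneq x c1; first by rewrite K1F //= andbF.
(* Otherwise the edge [a a'] of [B] and a perfect matching of the remaining outside would complete a
   matching of [K :\: T]. *)
have pmK1bad T : T \in F -> T \subset K1 -> ~~ pm e (K1 :\: T).
  move=> TF TK1; have [TK _ _ npm] := obsF TF; apply: contra npm => pmT.
  apply: (pm_cut (Y := K1 :\: T)) => //; first exact: setSD.
  have aT : (a \in T) = false by apply/negP => /(subsetP TK1); rewrite K1F.
  have a'T : (a' \in T) = false by apply/negP => /(subsetP TK1); rewrite K1F.
  apply: (pm_pair e_sym e_irr (x := a) (y := a')) => //; first by rewrite !inE aT K1F // (subsetP BK).
    by rewrite !inE a'T K1F // (subsetP BK).
  rewrite (_ : _ :\ a' = K :\: K1 :\ a :\ a'); first exact: pmadj.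
  apply/setP => v; move: (subset_implyb v TK1); rewrite !inE.
  by case: (v \in T); case: (v \in K1).
(* Lifts a matching in which [c1] and [c2] have partners [s1] and [s2] in [K1]: these are given
   actual neighbours [b1] and [b2], and [pm12] matches the rest of the outside. *)
have glue (T : {set V}) s1 b1 s2 b2 : T \subset K1 -> b1 \in B1 -> b2 \in B :\: B1 ->
    s1 \in K1 :\: T -> s2 \in K1 :\: T -> s1 != s2 -> e s1 b1 -> e s2 b2 ->
    pm e (K1 :\: T :\ s1 :\ s2) -> pm e (K :\: T).
  move=> TK1 b1B1 b2B2 s1T s2T s12 es1 es2 pms.
  have b1B := subsetP B1B b1 b1B1; have [b2B b2B1] := setDP b2B2.
  have b12 : b1 != b2 by apply: contraNneq b2B1 => <-.
  have TB b : b \in B -> (b \in T) = false.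
    by move=> bB; apply/negP => /(subsetP TK1); rewrite K1F.
  have /setDP[s1K /negbTE s1T'] := s1T; have /setDP[s2K /negbTE s2T'] := s2T.
  have nsb s b : s \in K1 -> b \in B -> (s == b) = false.
    by move=> sK bB; apply/eqP => sb; move: sK; rewrite sb K1F.
  have fs := (s1T', s2T', s1K, s2K, TB b1 b1B, TB b2 b2B, K1F b1 b1B, K1F b2 b2B,
    subsetP K1K _ s1K, subsetP K1K _ s2K, subsetP BK _ b1B, subsetP BK _ b2B, negbTE b12, negbTE s12,
    nsb _ _ s1K b1B, nsb _ _ s1K b2B, nsb _ _ s2K b1B, nsb _ _ s2K b2B).
  apply: (pm_pair e_sym e_irr (x := s1) (y := b1)); rewrite ?inE ?fs //.
  apply: (pm_pair e_sym e_irr (x := s2) (y := b2)); rewrite ?inE ?fs //.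
    by rewrite (eq_sym s2) fs.
  by rewrite eq_sym fs (eq_sym b2) fs.
  apply: (pm_cut (Y := K :\: K1 :\ b1 :\ b2)); last 1 first.
  - rewrite (_ : _ :\: _ = K1 :\: T :\ s1 :\ s2) //.
    apply/setP => v; move: (subset_implyb v K1K); rewrite !inE.
    have [->|_] := eqVneq v b1; first by rewrite ?fs ?andbF.
    have [->|_] := eqVneq v b2; first by rewrite ?fs ?andbF.
    by case: (v == s1); case: (v == s2); case: (v \in K1); case: (v \in T); case: (v \in K).
  - apply/subsetP => v; move: (subset_implyb v TK1); rewrite !inE.
    have [->|_] := eqVneq v s1; first by rewrite ?fs ?andbF.
    have [->|_] := eqVneq v s2; first by rewrite ?fs ?andbF.
    by case: (v == b1); case: (v == b2); case: (v \in K1); case: (v \in T); case: (v \in K).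
  - exact: pm12.
(* Lifts a matching of the complement of a contracted hyperedge: [b] is the outer vertex of [T], and
   the other contracted vertex becomes a neighbour [d] of its partner [s]. *)
have glue1 (T : {set V}) s b d : T :\: K1 = [set b] -> b \in B -> d \in B -> b != d ->
    pm e (K :\: K1 :\ b :\ d) -> s \in K1 :\: T -> e s d -> pm e (K1 :\: T :\ s) ->
    pm e (K :\: T).
  move=> Tb bB dB bd pmbd sKT esd pms; have /setDP[sK /negbTE sT] := sKT.
  have Tv v : (v \in T) && (v \notin K1) = (v == b).
    by have /setP/(_ v) := Tb; rewrite !inE andbC.
  have dT : (d \in T) = false.
    by have := Tv d; rewrite K1F // andbT eq_sym (negbTE bd).
  have sd : (s == d) = false by apply/eqP => sd; move: sK; rewrite sd K1F.
  apply: (pm_pair e_sym e_irr (x := s) (y := d)); rewrite ?inE ?sT ?dT ?(subsetP K1K _ sK) ?(subsetP BK _ dB) //.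
  apply: (pm_cut (Y := K :\: K1 :\ b :\ d)) => //; last first.
    rewrite (_ : _ :\: _ = K1 :\: T :\ s) //.
    apply/setP => v; move: (subset_implyb v K1K) (Tv v); rewrite !inE.
    have [->|_] := eqVneq v d; first by rewrite K1F // !andbF.
    have [->|_] := eqVneq v b; first by rewrite K1F // andbT => _ ->; rewrite !andbF.
    by case: (v == s); case: (v \in K1); case: (v \in T); case: (v \in K).
  apply/subsetP => v; move: (Tv v); rewrite !inE.
  have [->|_] := eqVneq v s; first by rewrite sK !andbF.
  by case: (v == b); case: (v == d); case: (v \in K1); case: (v \in T); case: (v \in K).
(* Two vertices [b], [b'] of [T] outside [K1] would be adjacent, and matchings of [K1 :\ x] and
   [K :\: K1 :\ b :\ b'] would combine to one of [K :\: T]. *)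
have types T : T \in F -> T :&: K1 != set0 ->
    T \subset K1 \/ exists2 b, b \in B & T :\: K1 = [set b].
  move=> TF /set0Pn[x /setIP[xT xK1]]; have [TK cT adjT npm] := obsF TF.
  have TB y : y \in T -> y \notin K1 -> y \in B.
    move=> yT yK1; have xy : x != y by apply: contraNneq yK1 => <-.
    have := nbrK1 x y xK1 (subsetP TK y yT) (adjT x y xT yT xy).
    by rewrite inE (negbTE yK1).
  have cTI : 0 < #|T :&: K1| by apply/card_gt0P; exists x; rewrite inE xT.
  have [c0|c1'|] : [\/ #|T :\: K1| = 0, #|T :\: K1| = 1 | #|T :\: K1| = 2].
    move: (cardsID K1 T) cTI; rewrite cT.
    by case: #|T :\: K1| => [|[|[|n]]]; [constructor 1|constructor 2|constructor 3|clear; lia].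
  - by left; rewrite -setD_eq0; apply/eqP/cards0_eq.
  - right; have /eqP/cards1P[b Tb] := c1'; exists b => //.
    by have : b \in T :\: K1; [rewrite Tb set11|case/setDP; apply: TB].
  move=> c2'; have /eqP/cards2P[b [b' [bb' Tb]]] := c2'.
  have /setDP[bT bK] : b \in T :\: K1 by rewrite Tb !inE eqxx.
  have /setDP[b'T b'K] : b' \in T :\: K1 by rewrite Tb !inE eqxx orbT.
  have Tx : T :&: K1 = [set x].
    apply/esym/eqP; rewrite eqEcard sub1set inE xT xK1 cards1.
    by have := cardsID K1 T; rewrite cT c2'; clear; lia.
  case/negP: npm; apply: (pm_cut (Y := K1 :\ x)).
  - apply/subsetP => v; rewrite !inE => /andP[vx vK]; rewrite (subsetP K1K) // andbT.
    by apply: contra vx => vT; rewrite -in_set1 -Tx inE vT.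
  - exact: (factor_criticalP _ _ fcK1).
  rewrite (_ : _ :\: _ = K :\: K1 :\ b :\ b'); first by apply: pmadj; rewrite ?TB //; apply: adjT.
  apply/setP => v; have /setP/(_ v) := Tx; have /setP/(_ v) := Tb; rewrite !inE.
  by case: (v == b); case: (v == b'); case: (v == x); case: (v \in K1); case: (v \in T); case: (v \in K).
(* The contracted hyperedges: those with one outer vertex, lying in the class [C], which is replaced
   by the representative [c]. *)
pose G c (C : {set V}) := [set c |: (T :&: K1) | T in
  [set T in F | (T :&: K1 != set0) && [exists b in C, T :\: K1 == [set b]]]].
have obsG c d (C D : {set V}) : K' = c |: (d |: K1) -> c != d -> c \notin K1 -> d \notin K1 ->
    C \subset B -> D \subset B ->
    (forall b b', b \in C -> b' \in D -> b != b' /\ pm e (K :\: K1 :\ b :\ b')) ->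
    (forall x, x \in K1 -> e0 x c = [exists b in C, e x b]) ->
    (forall x, x \in K1 -> e0 x d = [exists b in D, e x b]) ->
    obstructed e0 (G c C) K'.
  move=> eK' cd cK dK CB DB CD e0c e0d _ /imsetP[T /[!inE] /andP[TF /andP[TK0 /exists_inP[b bC /eqP Tb]]] ->].
  have [TK cT adjT npm] := obsF TF.
  have /setDP[bT bK1] : b \in T :\: K1 by rewrite Tb set11.
  have cTI : #|T :&: K1| = 2 by have := cardsID K1 T; rewrite Tb cards1 cT; clear; lia.
  have adjc x : x \in T :&: K1 -> e0 x c.
    case/setIP => xT xK1; rewrite e0c //; apply/exists_inP; exists b => //.
    by apply: adjT => //; apply: contraNneq bK1 => <-.
  split.
  - by rewrite eK'; apply: setUS; apply: subset_trans (subsetIr _ _) (subsetUr _ _).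
  - by rewrite cardsU1 cTI !inE (negbTE cK) andbF.
  - move=> x y /setU1P[->|xT] /setU1P[->|yT]; rewrite ?eqxx // => xy.
    + by rewrite e0sym adjc.
    + exact: adjc.
    + by case/setIP: xT yT => xT xK /setIP[yT yK]; rewrite e0K1 //; apply: adjT.
  have -> : K' :\: (c |: (T :&: K1)) = d |: (K1 :\: T).
    rewrite eK'; apply/setP => v; rewrite !inE.
    have [->|_] := eqVneq v c; first by rewrite (negbTE cd) (negbTE cK) !andbF.
    have [->|_] := eqVneq v d; first by rewrite (negbTE dK) !andbF.
    by case: (v \in K1); rewrite ?andbF ?andbT.
  apply: contra npm => /pmP[f fP].
  have [fd edf ffd] := fP d (setU11 _ _).
  have {fd} fd : f d \in K1 :\: T.
    by case/setU1P: fd => // fd; rewrite fd e0irr in edf.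
  have /setDP[fdK1 fdT] := fd.
  move: edf; rewrite e0sym e0d // => /exists_inP[b' b'D efb'].
  have [bb' pmb] := CD b b' bC b'D.
  apply: (glue1 T (f d) b b') => //; [exact: (subsetP CB)|exact: (subsetP DB)|].
  rewrite -pmK1; last by apply: subset_trans (subsetDl _ _) (subsetDl _ _).
  apply: (pm_restrict fP).
    by apply: subset_trans (subsetDl _ _) (subsetUr _ _).
  move=> y /setD1P[yfd yKT]; have [fy _ ffy] := fP y (setU1r _ yKT).
  have /setDP[yK1 _] := yKT.
  apply/setD1P; split.
    by apply: contraNneq dK => eqy; rewrite -ffd -eqy ffy.
  by case/setU1P: fy => // fyd; move: yfd; rewrite -fyd ffy eqxx.
pose F' := [set T in F | T \subset K1] :|: (G c1 B1 :|: G c2 (B :\: B1)).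
have obsF' : obstructed e0 F' K'.
  move=> T /setUP[|/setUP[]].
  - rewrite inE => /andP[TF TK1]; have [TK cT adjT npm] := obsF TF.
    split => //; first exact: subset_trans TK1 K1K'.
      by move=> x y xT yT xy; rewrite e0K1 ?(subsetP TK1) //; apply: adjT.
    have cT' c : c \in B -> (c \in T) = false.
      by move=> cB; apply/negP => /(subsetP TK1); rewrite K1F.
    apply/negP => /pmP[f fP].
    have c1X : c1 \in K' :\: T by rewrite !inE cT' // eqxx.
    have c2X : c2 \in K' :\: T by rewrite !inE cT' // eqxx orbT.
    have [f1 e1 ff1] := fP c1 c1X; have [f2 e2 ff2] := fP c2 c2X.
    have KTX : K1 :\: T \subset K' :\: T by apply: setSD.
    have inX v : v \in K' :\: T -> [\/ v = c1, v = c2 | v \in K1 :\: T].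
      rewrite !inE => /andP[vT /or3P[/eqP->|/eqP->|vK]]; [constructor 1|constructor 2|constructor 3] => //.
      by rewrite vT.
    have K1c v c : v \in K1 -> c \in B -> v <> c by move=> vK cB vc; move: vK; rewrite vc K1F.
    (* If [c1] is matched with [c2], the rest is a matching of [K1 :\: T], excluded by [pmK1bad];
       otherwise both have partners in [K1] and [glue] applies. *)
    case: (inX _ f1) => [f1c|f1c|f1K]; first by rewrite f1c e0irr in e1.
      have := pmK1bad T TF TK1; rewrite -pmK1 ?subsetDl // => /negP; apply.
      apply: (pm_restrict fP KTX) => y yKT; have [fy _ ffy] := fP y (subsetP KTX y yKT).
      have /setDP[yK _] := yKT.
      case: (inX _ fy) => // eqy; move: ffy; rewrite eqy ?f1c; first by move/esym/(K1c _ _ yK c2B).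
      by rewrite -f1c ff1 => /esym/(K1c _ _ yK c1B).
    case: (inX _ f2) => [f2c|f2c|f2K]; last 1 first.
    + have /setDP[f1K' _] := f1K; have /setDP[f2K' _] := f2K.
      move: e1 e2; rewrite (e0sym c1) (e0sym c2) e0c1 // e0c2 // => /exists_inP[b1 b1B eb1] /exists_inP[b2 b2B eb2].
      case/negP: npm; apply: (glue T (f c1) b1 (f c2) b2) => //.
        by apply: contraNneq c12 => f12; rewrite -ff1 -ff2 f12.
      rewrite -pmK1; last by apply/subsetP => v; rewrite !inE => /and3P[_ _ /andP[]].
      apply: (pm_restrict fP).
        by apply/subsetP => v; rewrite !inE => /and3P[_ _ /andP[-> ->]]; rewrite !orbT.
      move=> y /setD1P[yf2 /setD1P[yf1 yKT]]; have [fy _ ffy] := fP y (subsetP KTX y yKT).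
      have /setDP[yK _] := yKT.
      rewrite !inE; apply/and3P; split.
      * by apply/eqP => fyf; apply: (K1c _ _ yK c2B); rewrite -ffy fyf ff2.
      * by apply/eqP => fyf; apply: (K1c _ _ yK c1B); rewrite -ffy fyf ff1.
      * by case: (inX _ fy) => [fyc|fyc|]; [move: yf1|move: yf2|rewrite inE]; rewrite // -fyc ffy eqxx.
    + by move: (K1c _ _ (proj1 (setDP f1K)) c2B); rewrite -f2c in ff2 *; rewrite -{2}ff2 f2c.
    + by rewrite f2c e0irr in e2.
  - apply: (obsG c1 c2 B1 (B :\: B1)) => //; rewrite ?K1F ?subsetDl // => b b' bB1 b'B2.
    by split; [apply: contraTneq b'B2 => <-; rewrite inE bB1|apply: pm12].
  - apply: (obsG c2 c1 (B :\: B1) B1); rewrite ?K1F ?subsetDl 1?eq_sym //; first by rewrite setUCA.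
    move=> b b' bB2 b'B1; split; first by apply: contraTneq bB2 => ->; rewrite inE b'B1.
    rewrite (_ : _ :\ b' = K :\: K1 :\ b' :\ b); first exact: pm12.
    by apply/setP => v; rewrite !inE andbCA.
have ltK' : #|K'| < #|K| by rewrite cK'.
(* The edge claim at [c1], [c2] puts the support of the certificate inside [K1]. *)
have [z zP] : exists z, certificate z F' (K' :\: [set c1; c2]) 1.
  apply: (IH e0 F' K') => //; first by rewrite cK'.
    by rewrite !inE eqxx.
  by rewrite !inE eqxx orbT.
have eK1 : K' :\: [set c1; c2] = K1.
  apply/setP => v; rewrite !inE.
  have [->|_] := eqVneq v c1; first by rewrite K1F.
  by have [->|_] := eqVneq v c2; first by rewrite K1F.
rewrite {}eK1 in zP; exists z; case: zP => z1 z0 zF zk; split => // T TF.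
have [TK0|TK0] := eqVneq (T :&: K1) set0; first by rewrite (weight_supp _ z0) TK0 weight0.
have [TK1|[b bB Tb]] := types T TF TK0; first by apply: zF; rewrite !inE TF TK1.
(* As [z] vanishes outside [K1], a hyperedge weighs as much as its contraction. *)
have zG c (C : {set V}) : c \in B -> b \in C -> G c C \subset F' -> (weight z T <= 0)%R.
  move=> cB bC /subsetP GF'.
  have TG : c |: (T :&: K1) \in G c C.
    by apply/imsetP; exists T; rewrite // !inE TF TK0; apply/exists_inP; exists b; rewrite // Tb.
  have := zF _ (GF' _ TG); rewrite weight_set1U ?inE ?K1F ?andbF // (z0 c) ?K1F // add0r.
  by rewrite -(weight_supp _ z0).
have [bB1|bB1] := boolP (b \in B1).
  by apply: (zG c1 B1) => //; rewrite /F' setUCA subsetUl.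
by apply: (zG c2 (B :\: B1)); rewrite // ?inE ?bB1 // /F' setUA subsetUr.
Qed.

End OddLobe.

(** * The even rest beside a single odd part *)

Section EvenLobe.
Variables (V : finType) (e : rel V).
Hypotheses (e_sym : symmetric e) (e_irr : irreflexive e).
Variables (F : {set {set V}}) (K : {set V}).
Hypotheses (fcK : factor_critical e K) (obsF : obstructed e F K).

(* Contract everything outside of [R] to the single vertex [b]. *)
Lemma even_lobe (K1 : {set V}) b b' (R := K :\: K1 :\ b :\ b') :
  K1 \subset K -> K1 != set0 -> factor_critical e K1 ->
  b \in K :\: K1 -> b' \in K :\: K1 -> e b b' ->
  (forall x y, x \in K1 -> y \in K -> e x y -> y \in K1 :|: [set b; b']) ->
  touches e K1 b -> touches e K1 b' -> R != set0 -> pm e R ->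
  (forall (e' : rel V) (F' : {set {set V}}) (K' : {set V}), symmetric e' -> irreflexive e' ->
     #|K'| < #|K| -> 1 < #|K'| ->
     factor_critical e' K' -> obstructed e' F' K' -> vertex_claim e' F' K') ->
  forall c, c \in [set b; b'] -> exists z, certificate z F (c |: R) 1 /\ (z c <= 0)%R.
Proof.
move=> K1K K1n fcK1 bKK b'KK ebb' nbrK1 tb tb' Rn pmR IH.
have /setDP[bK /negbTE bK1] := bKK; have /setDP[b'K /negbTE b'K1] := b'KK.
have bb' : b != b' by apply: contraTneq ebb' => ->; rewrite e_irr.
have memR v : (v \in R) = [&& v != b', v != b, v \notin K1 & v \in K] by rewrite /R !inE.
move: R memR Rn pmR => {}R memR Rn pmR.
have bR : (b \in R) = false by rewrite memR eqxx andbF.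
have b'R : (b' \in R) = false by rewrite memR eqxx.
have RK1 v : v \in R -> (v \in K1) = false by rewrite memR => /and4P[_ _ /negbTE].
have RK : R \subset K by apply/subsetP => v; rewrite memR => /and4P[].
have inK v : v \in K -> [\/ v \in R, v \in K1, v = b | v = b'].
  move=> vK; rewrite memR vK; have [->|_] := eqVneq v b'; first by constructor 4.
  have [->|_] := eqVneq v b; first by constructor 3.
  by case: (v \in K1); [constructor 2|constructor 1].
have nK1R x y : x \in K1 -> y \in R -> e x y = false.
  move=> xK yR; apply/negP => exy; have := nbrK1 x y xK (subsetP RK y yR) exy.
  by rewrite !inE RK1 //=; case/orP => /eqP yb; move: yR; rewrite yb ?bR ?b'R.
pose t x := e x b || e x b'.
(* The vertex [b] now represents both [b] and [b']: it is adjacent to each vertex of [R] that has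
   either of them as a neighbour. *)
pose e0 x y := if x \in R then if y \in R then e x y else (y == b) && t x
  else [&& x == b, y \in R & t y].
have e0sym : symmetric e0.
  move=> x y; rewrite /e0; have [xR|xR] := boolP (x \in R); have [yR|yR] := boolP (y \in R) => //=.
  by rewrite !andbF.
have e0irr : irreflexive e0 by move=> x; rewrite /e0; case: (x \in R); rewrite ?e_irr ?andbF.
have e0R x y : x \in R -> y \in R -> e0 x y = e x y by rewrite /e0 => -> ->.
have e0b x : x \in R -> e0 x b = t x by rewrite /e0 => ->; rewrite bR eqxx.
have pmR0 (X : {set V}) : X \subset R -> pm e0 X = pm e X.
  move=> /subsetP XK; apply/idP/idP; apply: pm_sub_rel => x y xX yX; by rewrite e0R ?XK.
pose Z := b |: R.
have tc c : c \in [set b; b'] -> touches e K1 c by rewrite !inE => /orP[]/eqP->.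
have cK1 c : c \in [set b; b'] -> (c \in K1) = false by rewrite !inE => /orP[]/eqP->.
have cR c : c \in [set b; b'] -> (c \in R) = false by rewrite !inE => /orP[]/eqP->.
have oddK1 : odd #|K1| by apply: factor_critical_odd fcK1.
have fcZ : factor_critical e0 Z.
  apply/factor_criticalP => v /setU1P[->|vR]; first by rewrite setU1K ?bR // pmR0.
  have vK := subsetP RK v vR.
  have /pmP[f fP] : pm e (K :\ v) by apply: (factor_criticalP _ _ fcK).
  have K1Kv : K1 \subset K :\ v.
    by apply/subsetP => x xK1; rewrite !inE (subsetP K1K) // andbT; apply: contraTneq xK1 => ->; rewrite RK1.
  have vb c : c \in [set b; b'] -> c != v.
    by move=> cb; apply: contraTneq vR => <-; rewrite cR.
  have bX : b \in K :\ v by rewrite !inE bK vb // !inE eqxx.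
  have b'X : b' \in K :\ v by rewrite !inE b'K vb // !inE eqxx orbT.
  have [fbX efb ffb] := fP b bX; have [fb'X efb' ffb'] := fP b' b'X.
  have K1out x : x \in K1 -> f x \notin K1 -> f x \in [set b; b'].
    move=> xK fxK; have [/setD1P[_ fx] ex _] := fP x (subsetP K1Kv x xK).
    by have := nbrK1 x (f x) xK fx ex; rewrite inE (negbTE fxK).
  (* [K1] is odd and sees only [b] and [b'] outside itself, so a perfect matching of [K :\ v] sends
     exactly one of them, [c1], into [K1]. The other, [c2], is then matched into [R], and [b] takes
     over its partner. *)
  have key : exists c1 c2, [/\ [set c1; c2] = [set b; b'], f c1 \in K1 & f c2 \notin K1].
    have [fbK|fbK] := boolP (f b \in K1); have [fb'K|fb'K] := boolP (f b' \in K1).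
    - have /(pm_even e_irr) evK : pm e (K1 :\ f b :\ f b').
        apply: (pm_restrict fP) => [|x /setD1P[xb' /setD1P[xb xK]]].
          by apply: subset_trans K1Kv; rewrite !subDset !subsetU ?subxx ?orbT.
        have [_ _ ffx] := fP x (subsetP K1Kv x xK).
        have fxK : f x \in K1.
          apply: contraTT isT => fxK; have := K1out x xK fxK; rewrite !inE.
          by case/orP => /eqP fx; [move: xb|move: xb']; rewrite -fx ffx eqxx.
        rewrite !inE fxK andbT; apply/andP; split.
          by apply/eqP => fx; move: xK; rewrite -ffx fx ffb' b'K1.
        by apply/eqP => fx; move: xK; rewrite -ffx fx ffb bK1.
      have nfb : f b' != f b by apply: contraNneq bb' => fe; rewrite -ffb -fe ffb'.
      have := cardsD1 (f b) K1; have := cardsD1 (f b') (K1 :\ f b).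
      rewrite !inE fbK fb'K nfb => -> eK1; move: oddK1; rewrite eK1 /= negbK => oK.
      by rewrite oK in evK.
    - by exists b, b'.
    - by exists b', b; rewrite setUC.
    - have /(pm_even e_irr) evK : pm e K1.
        apply: (pm_restrict fP K1Kv) => x xK; have [_ _ ffx] := fP x (subsetP K1Kv x xK).
        apply/negPn/negP => fxK; have := K1out x xK fxK; rewrite !inE.
        by case/orP => /eqP fx; [move: fbK|move: fb'K]; rewrite -fx ffx xK.
      by rewrite oddK1 in evK.
  case: key => c1 [c2 [ec fc1 fc2]].
  have c1b : c1 \in [set b; b'] by rewrite -ec !inE eqxx.
  have c2b : c2 \in [set b; b'] by rewrite -ec !inE eqxx orbT.
  have inX c : c \in [set b; b'] -> c \in K :\ v by rewrite !inE => /orP[]/eqP->; [move: bX|move: b'X]; rewrite !inE.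
  have [fc1X efc1 ffc1] := fP c1 (inX _ c1b); have [fc2X efc2 ffc2] := fP c2 (inX _ c2b).
  have c2n : f c2 \in R :\ v.
    have /setD1P[fv fK] := fc2X; rewrite in_setD1 fv.
    have : f c2 \notin [set c1; c2].
      rewrite !inE negb_or; apply/andP; split; last by apply: contraTneq efc2 => ->; rewrite e_irr.
      apply/eqP => eq1; move: fc1; rewrite -eq1 ffc2 cK1 //.
    rewrite ec; case: (inK _ fK) => // [|->|->]; rewrite ?(negbTE fc2) // !inE eqxx ?orbT //.
  have /setD1P[fc2v fc2R] := c2n.
  rewrite (_ : Z :\ v = [set f c2; b] :|: (R :\ v :\ f c2)); last first.
    apply/setP => x; rewrite !inE.
    have [->|_] := eqVneq x b; first by rewrite vb ?orbT // !inE eqxx.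
    by have [->|_] := eqVneq x (f c2); rewrite //= fc2v.
  apply: pmU.
  - rewrite -setI_eq0; apply/eqP/setP => x; rewrite in_setI in_set2 in_set0 2!in_setD1.
    have [->|_] := eqVneq x (f c2); first by [].
    by have [->|_] := eqVneq x b; rewrite // bR !andbF.
  - apply: pm2 => //; rewrite e0b // /t; move: efc2 c2b; rewrite e_sym !inE => efc2.
    by case/orP => /eqP c2b; move: efc2; rewrite c2b => ->; rewrite ?orbT.
  - rewrite pmR0; last by rewrite !subDset !subsetU ?subxx ?orbT.
    have RX : R :\ v :\ f c2 \subset K :\ v.
      by apply/subsetP => x; rewrite in_setD1 => /andP[_]; apply: (subsetP (setSD _ RK)).
    apply: (pm_restrict fP RX) => y /setD1P[yf yRv].
    have /setD1P[yv yR] := yRv.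
    have yX : y \in K :\ v by rewrite in_setD1 yv (subsetP RK).
    have [/setD1P[fyv fyK] efy ffy] := fP y yX.
    rewrite 2!in_setD1 fyv andTb; apply/andP; split.
      by apply: contraTneq yR => eqy; rewrite -ffy eqy ffc2 cR.
    have nfy c : c \in [set c1; c2] -> f y != c.
      rewrite !inE => /orP[]/eqP->; apply/eqP => eqy.
        by move: fc1; rewrite -eqy ffy RK1.
      by move: yf; rewrite -eqy ffy eqxx.
    case: (inK _ fyK) => // [fyK1|fyb|fyb].
    + by move: efy; rewrite e_sym nK1R.
    + by move: (nfy b); rewrite ec !inE fyb !eqxx => /(_ isT).
    + by move: (nfy b'); rewrite ec !inE fyb !eqxx orbT => /(_ isT).
pose ord c1 c2 := (c1 == b) && (c2 == b') || (c1 == b') && (c2 == b).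
have ordP c1 c2 : ord c1 c2 -> [/\ c1 \in [set b; b'], c2 \in [set b; b'], c1 \in K, c2 \in K & c1 != c2].
  by case/orP => /andP[/eqP-> /eqP->]; rewrite !inE !eqxx ?orbT //; split => //; rewrite eq_sym.
have ordR c1 c2 v : ord c1 c2 -> (v \in R) = [&& v != c2, v != c1, v \notin K1 & v \in K].
  by case/orP => /andP[/eqP-> /eqP->]; rewrite memR // andbCA.
have pmc c : c \in [set b; b'] -> pm e (c |: K1).
  by move=> cb; apply: pm_attach => //; rewrite ?cK1 ?tc.
(* The partner [s] of the contracted vertex is given its actual neighbour [c1]; the other vertex
   [c2] is matched together with [K1]. *)
have glue (T : {set V}) c1 c2 s : T \subset R -> ord c1 c2 -> s \in R :\: T ->
    e s c1 -> pm e (R :\: T :\ s) -> pm e (K :\: T).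
  move=> TR oc sRT esc pms; have [c1b c2b c1K c2K c12] := ordP _ _ oc.
  have /setDP[sR /negbTE sT] := sRT.
  have cT c : c \in [set b; b'] -> (c \in T) = false.
    by move=> cb; apply/negP => /(subsetP TR); rewrite cR.
  apply: (pm_pair e_sym e_irr (x := s) (y := c1)); rewrite ?inE ?sT ?cT ?(subsetP RK _ sR) //.
  apply: (pm_cut (Y := c2 |: K1)); last 1 first.
  - rewrite (_ : _ :\: _ = R :\: T :\ s) //.
    apply/setP => v; rewrite !inE (ordR c1 c2) //.
    by case: (v == s); case: (v == c1); case: (v == c2); case: (v \in K1); case: (v \in T); case: (v \in K).
  - apply/subsetP => v; rewrite in_setU1 !inE => /orP[/eqP->|vK1].
      rewrite eq_sym c12 cT // c2K !andbT.
      by apply: contraTneq sR => <-; rewrite cR.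
    rewrite (subsetP K1K) // andbT; apply/and3P; split.
    + by apply: contraTneq vK1 => ->; rewrite cK1.
    + by apply: contraTneq vK1 => ->; rewrite RK1.
    + by apply/negP => /(subsetP TR) vR; rewrite RK1 in vK1.
  - exact: pmc.
have glue1 (T : {set V}) c1 c2 : T :\: R = [set c1] -> ord c1 c2 -> pm e (R :\: T) -> pm e (K :\: T).
  move=> Tc oc pmT; have [c1b c2b c1K c2K c12] := ordP _ _ oc.
  have Tv v : (v \in T) && (v \notin R) = (v == c1).
    by have /setP/(_ v) := Tc; rewrite !inE andbC.
  apply: (pm_cut (Y := c2 |: K1)); last 1 first.
  - rewrite (_ : _ :\: _ = R :\: T) //.
    apply/setP => v; move: (Tv v); rewrite !inE (ordR c1 c2) //.
    by case: (v == c1); case: (v == c2); case: (v \in K1); case: (v \in T); case: (v \in K).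
  - apply/subsetP => v; move: (Tv v); rewrite in_setU1 in_setD => Tv' /orP[/eqP ev|vK1].
      by rewrite ev c2K andbT; move: Tv'; rewrite ev cR // andbT eq_sym (negbTE c12) => ->.
    rewrite (subsetP K1K) // andbT; apply/negP => vT; move: Tv'.
    rewrite vT; have [/RK1|/= _ /esym/eqP vc] := boolP (v \in R); first by rewrite vK1.
    by rewrite vc cK1 in vK1.
  - exact: pmc.
have TRb T x : T \in F -> x \in T :&: R -> T :\: R \subset [set b; b'].
  move=> TF /setIP[xT xR]; have [TK _ adjT _] := obsF TF; apply/subsetP => y /setDP[yT yR].
  have exy : e x y by apply: adjT => //; apply: contraNneq yR => <-.
  have yK := subsetP TK y yT; rewrite !inE.
  case: (inK _ yK) => [|yK1|->|->]; rewrite ?eqxx ?orbT ?(negbTE yR) //.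
  by move: exy; rewrite e_sym nK1R.
pose F' := [set T in F | T \subset R] :|: [set b |: (T :&: R) | T in [set T in F | #|T :&: R| == 2]].
have TRc T : T \in F -> #|T :&: R| = 2 -> exists c1 c2, ord c1 c2 /\ T :\: R = [set c1].
  move=> TF c2; have [TK cT adjT _] := obsF TF.
  have /eqP/cards1P[c Tc] : #|T :\: R| = 1 by have := cardsID R T; rewrite cT c2; clear; lia.
  have /card_gt0P[x xTR] : 0 < #|T :&: R| by rewrite c2.
  have : c \in [set b; b'] by apply: (subsetP (TRb T x TF xTR)); rewrite Tc set11.
  by rewrite !inE => /orP[]/eqP ec; [exists c, b'|exists c, b]; split; rewrite // /ord ec !eqxx ?orbT.
have obsF' : obstructed e0 F' Z.
  move=> T /setUP[|/imsetP[{}T /[!inE] /andP[TF /eqP cTI] ->]].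
    rewrite inE => /andP[TF TR]; have [TK cT adjT npm] := obsF TF.
    split => //; first exact: subset_trans TR (subsetUr _ _).
      by move=> x y xT yT xy; rewrite e0R ?(subsetP TR) //; apply: adjT.
    apply/negP => /pmP[f fP].
    have bT : b \notin T by apply/negP => /(subsetP TR); rewrite bR.
    have bX : b \in Z :\: T by rewrite !inE bT eqxx.
    have [fbX efb ffb] := fP b bX.
    have sRT : f b \in R :\: T.
      move: fbX; rewrite !inE; case: eqP => [fb|//]; by rewrite fb e0irr in efb.
    have /setDP[sR _] := sRT.
    have pms : pm e (R :\: T :\ f b).
      rewrite -pmR0; last by apply/subsetP => y /setD1P[_ /setDP[]].
      apply: (pm_restrict fP).
        by apply/subsetP => y /setD1P[_ /setDP[yR yT]]; rewrite !inE yR yT orbT.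
      move=> y /setD1P[yfb yRT]; have [yR yT] := setDP yRT.
      have [|fyX _ ffy] := fP y; first by rewrite !inE yR yT orbT.
      rewrite in_setD1; apply/andP; split.
        by apply: contraTneq yR => eqy; rewrite -ffy eqy ffb bR.
      move: fyX; rewrite !inE; case: eqP => [fyb|//]; by rewrite -fyb ffy eqxx in yfb.
    move: efb; rewrite e0sym e0b // => /orP[] efb; case/negP: npm.
      by apply: (glue T b b' (f b)) => //; rewrite /ord !eqxx.
    by apply: (glue T b' b (f b)) => //; rewrite /ord !eqxx orbT.
  have [TK cT adjT npm] := obsF TF.
  have [c1 [c2 [oc Tc]]] := TRc T TF cTI; have [c1b _ _ _ _] := ordP _ _ oc.
  have /setDP[c1T c1R] : c1 \in T :\: R by rewrite Tc set11.
  have adjb x : x \in T :&: R -> e0 x b.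
    case/setIP => xT xR; rewrite e0b // /t.
    have : e x c1 by apply: adjT => //; apply: contraNneq c1R => <-.
    by move: c1b; rewrite !inE => /orP[]/eqP-> ->; rewrite ?orbT.
  split.
  - by apply: setUS; apply: subsetIr.
  - by rewrite cardsU1 cTI !inE bR andbF.
  - move=> x y /setU1P[->|xT] /setU1P[->|yT]; rewrite ?eqxx // => xy.
    + by rewrite e0sym adjb.
    + exact: adjb.
    + by case/setIP: xT yT => xT xR /setIP[yT yR]; rewrite e0R //; apply: adjT.
  have -> : Z :\: (b |: (T :&: R)) = R :\: T.
    apply/setP => v; rewrite !inE; have [->|_] := eqVneq v b; first by rewrite bR !andbF.
    by case: (v \in R); rewrite ?andbF ?andbT.
  by apply: contra npm; rewrite pmR0 ?subsetDl //; apply: glue1 Tc oc.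
have cardK : #|R| + #|K1| + 2 <= #|K|.
  have cb : #|[set b; b']| = 2 by rewrite cards2 bb'.
  have -> : #|R| + #|K1| + 2 = #|R :|: K1 :|: [set b; b']|.
    rewrite cardsU cb (_ : (_ :|: _) :&: _ = set0) ?cards0 ?subn0.
      rewrite cardsU (_ : _ :&: _ = set0) ?cards0 ?subn0 //.
      by apply/setP => v; rewrite !inE; apply/negP => /andP[/RK1->].
    apply/setP => v; rewrite in_setI in_setU in_set0; apply/negP => /andP[/orP[]] h1 h2.
      by rewrite cR in h1.
    by rewrite cK1 in h1.
  apply: subset_leq_card; by rewrite !subUset !sub1set RK K1K bK b'K.
have K1gt : 0 < #|K1| by rewrite card_gt0.
have Rgt : 0 < #|R| by rewrite card_gt0.
have cZ : #|Z| = #|R|.+1 by rewrite /Z cardsU1 bR.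
have eZ : Z :\ b = R by rewrite /Z setU1K ?bR.
have bZ : b \in Z by rewrite setU11.
have [||z] := IH e0 F' Z e0sym e0irr _ _ fcZ obsF' b bZ.
- by rewrite cZ; move: cardK K1gt; clear; lia.
- by rewrite cZ ltnS.
rewrite {}eZ => zP.
(* The flag [k] tells the two alternatives of the vertex claim apart: the total is at least [1 + k],
   and neighbours of [b] weigh at most [k]. *)
have [k [le1 z0 zT zk zn]] : exists k : bool,
    [/\ forall v, (z v <= 1)%R, forall v, v \notin R -> z v = 0%R,
       forall T, T \in F' -> (weight z T <= 0)%R, (1 + (k : nat)%:Z <= weight z R)%R &
       forall v, v \in R -> t v -> (z v <= (k : nat)%:Z)%R].
  case: zP => [[le1 z0 zT zk]|[[le1 z0 zT zk] zn]]; [exists true|exists false]; split => //.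
  by move=> v vR tv; apply: zn; rewrite ?inE ?vR ?orbT // e0sym e0b.
(* Weight [- k] on [c] leaves a total of at least 1. A hyperedge with just one vertex in [R]
   contains [b] and [b'], hence [c], and its vertex in [R] weighs at most [k]. *)
move=> c cb; exists (fun v => if v == c then - (k : nat)%:Z else z v)%R.
rewrite eqxx oppr_le0; split => //.
have wzc (T : {set V}) : weight (fun v => if v == c then - (k : nat)%:Z else z v)%R T =
    (weight z T - (c \in T : nat)%:Z * (k : nat)%:Z)%R.
  have [cT|cT] := boolP (c \in T); last first.
    rewrite mul0r subr0; apply: eq_weight => v vT; case: eqP => // vc; by rewrite -vc vT in cT.
  rewrite -(setD1K cT) !weight_set1U ?setD11 // eqxx (z0 c) ?cR //.
  rewrite (@eq_weight _ _ z) => [|v]; first by rewrite mul1r add0r addrC.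
  by rewrite in_setD1 => /andP[/negbTE->].
split.
- by move=> v; case: ifP => // _; clear; lia.
- by move=> v; rewrite in_setU1 negb_or => /andP[/negbTE-> /z0].
- move=> T TF; rewrite wzc.
  suff: (weight z T <= 0)%R \/ (c \in T) /\ (weight z T <= (k : nat)%:Z)%R.
    by case=> [wT|[-> wT]]; move: wT; case: k {zk zn wzc} => /=; try (case: (c \in T) => /=); clear; lia.
  have [TR0|/set0Pn[x xTR]] := eqVneq (T :&: R) set0.
    by left; rewrite (weight_supp _ z0) TR0 weight0.
  have [TK cT adjT _] := obsF TF; have /setIP[xT xR] := xTR.
  have TR := TRb T x TF xTR.
  have cTI : 0 < #|T :&: R| by apply/card_gt0P; exists x.
  have : [\/ #|T :&: R| = 1, #|T :&: R| = 2 | #|T :\: R| = 0].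
    have := cardsID R T; rewrite cT; case: #|T :&: R| cTI => [//|[|[|n]]] _;
    by [constructor 1|constructor 2|clear => ?; constructor 3; lia].
  case => [c1'|c2'|c0].
  + right; have Tx : T :&: R = [set x].
      by apply/esym/eqP; rewrite eqEcard sub1set xTR cards1 c1'.
    have TRe : T :\: R = [set b; b'].
      apply/eqP; rewrite eqEcard TR cards2 bb'.
      by have := cardsID R T; rewrite cT c1'; clear; lia.
    split; first by have : c \in T :\: R; [rewrite TRe|case/setDP].
    rewrite (weight_supp _ z0) Tx weight1; apply: zn => //.
    have bT : b \in T by have : b \in T :\: R; [rewrite TRe !inE eqxx|case/setDP].
    by rewrite /t adjT //; apply: contraTneq xR => ->; rewrite bR.
  + left; have := zT (b |: (T :&: R)); rewrite weight_set1U ?inE ?bR ?andbF // (z0 b) ?bR // add0r.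
    rewrite -(weight_supp _ z0) => -> //; apply/orP; right; apply/imsetP; exists T => //.
    by rewrite inE TF c2'.
  + left; apply: zT; rewrite !inE TF; apply/orP; left.
    by rewrite -setD_eq0; apply/eqP/cards0_eq.
- rewrite wzc setU11 weight_set1U ?cR // (z0 c) ?cR //; move: zk; clear; lia.
Qed.

End EvenLobe.

(** * Barriers of factor-critical sets *)

Section Structure.
Variables (V : finType) (e : rel V).
Hypotheses (e_sym : symmetric e) (e_irr : irreflexive e).
Variables (F : {set {set V}}) (K : {set V}).
Implicit Types (Q P : {set {set V}}) (B L : {set V}).

(* The minimality [eb_min] ensures that the ends of an edge inside [B] can be spared: the rest of
   [B] still matches all parts but any given one. *)
Record edge_barrier Q B : Prop := EdgeBarrier {
  eb_triv : trivIset Q;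
  eb_sub : forall L, L \in Q -> L \subset K;
  eb_neq0 : forall L, L \in Q -> L != set0;
  eb_critical : forall L, L \in Q -> factor_critical e L;
  eb_sep : separated e Q;
  eb_subB : B \subset K;
  eb_disj : forall L, L \in Q -> [disjoint L & B];
  eb_nbr : forall L x y, L \in Q -> x \in L -> y \in K -> e x y -> y \in L :|: B;
  eb_touch : forall b, b \in B -> exists2 L, L \in Q & touches e L b;
  eb_hall : forall Q', Q' \subset Q -> Q' != set0 -> #|Q'| < #|nbrs_in (touches e) B Q'|;
  eb_card : #|B| = #|Q|.+1;
  eb_edge : exists b b', [/\ b \in B, b' \in B & e b b'];
  eb_min : forall Q', Q' \subset Q -> Q' != Q -> Q' != set0 ->
    #|nbrs_in (touches e) B Q'| <= #|Q'|.+1 ->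
    {in nbrs_in (touches e) B Q' &, forall b b', ~~ e b b'};
  eb_rest : pm e (K :\: cover Q :\: B);
  eb_rest_neq0 : #|Q| = 1 -> K :\: cover Q :\: B != set0 }.

Hypotheses (fcK : factor_critical e K) (obsF : obstructed e F K).

(** Add [T0] to a barrier of [K :\: T0]. Criticality of [K] makes Hall's condition strict, and
    parity makes it tight for the family of all parts, whose neighbourhood contains the edges inside
    [T0]. A smallest tight family whose neighbourhood spans an edge is then as required. *)
Lemma edge_barrier_exists T0 : T0 \in F -> exists Q B, edge_barrier Q B.
Proof.
move=> T0F; have [T0K cT0 adjT0 npm] := obsF T0F.
have [A [P [/and3P[AX pP sP] fcP hallA]]] := tutte_strong e_sym e_irr (K :\: T0).
have K0 : K != set0.
  by rewrite -card_gt0; have := subset_leq_card T0K; rewrite cT0; clear; lia.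
have oddK := factor_critical_odd e_irr K0 fcK.
have tP := partition_trivIset pP; have cP := cover_partition pP.
have nP L : L \in P -> L != set0 by apply: partition_neq0 pP.
have ltAP : #|A| < #|P|.
  rewrite ltnNge; apply: contra npm => leP.
  by apply: pm_barrier hallA leP => //; apply/and3P.
pose B0 := A :|: T0.
have B0K : B0 \subset K by rewrite subUset T0K (subset_trans AX (subsetDl _ _)).
have AT0 : [disjoint A & T0].
  rewrite -setI_eq0; apply/eqP/setP => v; rewrite !inE; apply/negP => /andP[/(subsetP AX)].
  by rewrite inE => /andP[/negbTE->].
have cB0 : #|B0| = #|A| + 3 by rewrite /B0 cardsU (disjoint_setI0 AT0) cards0 subn0 cT0.
(* [#|K :\: T0|] is even, so [#|P| > #|A|] improves to [#|P| >= #|A| + 2]. *)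
have leB0 : #|B0| <= #|P|.+1 /\ 1 < #|P|.
  have := odd_card_partition pP.
  have -> : odd_parts P = #|P|.
    apply: eq_card => L; rewrite inE; case LP: (L \in P) => //=.
    by apply: factor_critical_odd (fcP _ LP) => //; apply: nP.
  have := cardsID A (K :\: T0); rewrite (setIidPr AX) => e1.
  have := cardsID T0 K; rewrite (setIidPr T0K) cT0 => e2.
  by rewrite cB0; move: oddK ltAP e1 e2; clear; lia.
have LK L : L \in P -> L \subset K.
  by move=> LP; apply: subset_trans (partitionS pP LP) _; rewrite setDDl subsetDl.
have LB L : L \in P -> [disjoint L & B0].
  move=> LP; rewrite -setI_eq0; apply/eqP/setP => v; rewrite !inE; apply/negP => /andP[vL].
  have := subsetP (partitionS pP LP) v vL; rewrite !inE => /and3P[/negbTE-> /negbTE->].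
  by [].
have nbrP L x y : L \in P -> x \in L -> y \in K -> e x y -> y \in L :|: B0.
  move=> LP xL yK exy; rewrite inE; have [yB|yB] := boolP (y \in B0); first by rewrite orbT.
  have : y \in cover P by rewrite cP !inE yK; move: yB; rewrite !inE => /norP[-> ->].
  case/bigcupP => M MP yM; have [<-|LM] := eqVneq M L; first by rewrite yM.
  by have /negP[] := separatedP _ _ sP L M x y LP MP (introN eqP (fun h => negP LM (introT eqP (esym h)))) xL yM.
pose nb Q := nbrs_in (touches e) B0 Q.
(* A perfect matching of [K :\ v] must leave every part at least once, since parts are odd, and it
   can leave only into [B0 :\ v]. *)
have leave v : v \in B0 -> exists f : V -> V,
    (forall x, x \in K :\ v -> [/\ f x \in K :\ v, e x (f x) & f (f x) = x]) /\
    forall L, L \in P -> exists2 x, x \in L & f x \in nb [set L] :\ v.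
  move=> vB; have vK := subsetP B0K v vB.
  have /pmP[f fP] := factor_criticalP _ _ fcK v vK; exists f; split => // L LP.
  have LKv : L \subset K :\ v.
    apply/subsetP => x xL; rewrite !inE (subsetP (LK L LP)) // andbT.
    by apply: contraTneq vB => <-; rewrite (disjointFr (LB L LP) xL).
  have [/forall_inP fL|/forall_inPn[x xL fx]] := boolP [forall x in L, f x \in L].
    have /(pm_even e_irr) : pm e L by apply: pm_restrict fP LKv fL.
    by rewrite (factor_critical_odd e_irr (nP L LP) (fcP L LP)).
  have [/setD1P[fxv fxK] efx _] := fP x (subsetP LKv x xL).
  exists x => //; rewrite in_setD1 fxv; apply/nbrs_inP.
  have := nbrP L x _ LP xL fxK efx; rewrite inE (negbTE fx) => fxB; split => //.
  by exists L; rewrite ?set11 //; apply/touchesP; exists x.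
have inj f v Q : Q \subset P -> v \in B0 ->
    (forall x, x \in K :\ v -> [/\ f x \in K :\ v, e x (f x) & f (f x) = x]) ->
    (forall L, L \in P -> exists2 x, x \in L & f x \in nb [set L] :\ v) ->
    exists h : {set V} -> V, {in Q &, injective h} /\
      forall L, L \in Q -> h L \in nb Q :\ v /\ exists2 x, x \in L & h L = f x.
  move=> QP vB fP fL.
  exists (fun L => odflt v [pick y in nb [set L] :\ v | [exists x in L, f x == y]]).
  have hP L : L \in Q -> let y := odflt v [pick y in nb [set L] :\ v | [exists x in L, f x == y]] in
      y \in nb Q :\ v /\ exists2 x, x \in L & y = f x.
    move=> LQ; case: pickP => [y /andP[/setD1P[yv yL] /exists_inP[x xL /eqP fx]]|no] /=.
      split; last by exists x.
      rewrite in_setD1 yv; apply/nbrs_inP; have /nbrs_inP[yB [M]] := yL.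
      by rewrite inE => /eqP->; split => //; exists L.
    have [x xL fx] := fL L (subsetP QP L LQ); have := no (f x); rewrite fx /=.
    by move/negbT/exists_inP; case; exists x.
  split => [L M LQ MQ eh|L LQ]; last exact: hP.
  have [_ [x xL ex]] := hP L LQ; have [_ [y yM ey]] := hP M MQ.
  have exy : f x = f y by rewrite -ex -ey.
  have LP := subsetP QP L LQ; have MP := subsetP QP M MQ.
  have inX N w : N \in P -> w \in N -> w \in K :\ v.
    move=> NP wN; rewrite !inE (subsetP (LK N NP)) // andbT.
    by apply: contraTneq vB => <-; rewrite (disjointFr (LB N NP) wN).
  have [_ _ fx] := fP x (inX L x LP xL); have [_ _ fy] := fP y (inX M y MP yM).
  have xy : x = y by rewrite -fx exy fy.
  apply/eqP; apply/negPn/negP => LM; have /trivIsetP/(_ L M LP MP LM) := tP.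
  by move/disjointFr/(_ xL); rewrite xy yM.
have [t0 t0T] : exists t0, t0 \in T0 by apply/card_gt0P; rewrite cT0.
(* Deleting a vertex [v] of [nb Q] itself still leaves room for all parts of [Q], which gives the
   strict inequality. *)
have hall0 Q : Q \subset P -> Q != set0 -> #|Q| < #|nb Q|.
  move=> QP /set0Pn[L0 L0Q].
  have [v vB vN] : exists2 v, v \in B0 & (v \in nb Q) || (nb Q == set0).
    have [n0|/set0Pn[v vN]] := eqVneq (nb Q) set0; last by exists v; rewrite ?vN //; case/nbrs_inP: vN.
    by exists t0; rewrite ?orbT // inE t0T orbT.
  have [f [fP fL]] := leave v vB; have [h [hinj hP]] := inj f v Q QP vB fP fL.
  have le : #|Q| <= #|nb Q :\ v|.
    rewrite -(card_in_imset hinj); apply/subset_leq_card/subsetP => _ /imsetP[L LQ ->].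
    by have [] := hP L LQ.
  case/orP: vN => [vN|/eqP n0]; first by rewrite (cardsD1 v) vN.
  by have [] := hP L0 L0Q; rewrite n0 !inE andbF.
have nbB0 : nb P = B0.
  apply/eqP; rewrite eqEcard; apply/andP; split; first by apply/subsetP => v /nbrs_inP[].
  have P0 : P != set0 by rewrite -card_gt0; apply: leq_ltn_trans ltAP.
  by apply: leq_trans (hall0 P (subxx _) P0); case: leB0.
pose good Q := [&& Q \subset P, Q != set0, #|nb Q| <= #|Q|.+1 &
                   [exists b in nb Q, exists b' in nb Q, e b b']].
have goodP : good P.
  apply/and4P; split; rewrite ?nbB0 ?subxx //; last 1 first.
  - have /card_gt0P[t1] : 0 < #|T0 :\ t0| by have := cardsD1 t0 T0; rewrite cT0 t0T; clear; lia.
    rewrite in_setD1 => /andP[t10 t1T].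
    apply/exists_inP; exists t0; first by rewrite inE t0T orbT.
    apply/exists_inP; exists t1; first by rewrite inE t1T orbT.
    by apply: adjT0; rewrite // eq_sym.
  - by rewrite -card_gt0; apply: leq_ltn_trans ltAP.
  - by case: leB0.
have [Q /and4P[QP Q0 tightQ /exists_inP[b bQ /exists_inP[b' b'Q ebb']]] minQ] :=
  arg_minnP (fun Q : {set {set V}} => #|Q|) goodP.
have nbin Q' : Q' \subset Q -> nbrs_in (touches e) (nb Q) Q' = nb Q'.
  move=> /subsetP Q'Q; apply/setP => v; apply/nbrs_inP/nbrs_inP => [[/nbrs_inP[vB _]]|[vB [L LQ' tL]]].
    by [].
  by split; [apply/nbrs_inP; split => //; exists L; rewrite ?Q'Q|exists L].
have nbQB : nb Q \subset B0 by apply/subsetP => v /nbrs_inP[].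
have cardnb : #|nb Q| = #|Q|.+1 by apply/eqP; rewrite eqn_leq tightQ hall0.
exists Q, (nb Q); split.
- exact: trivIsetS QP tP.
- by move=> L /(subsetP QP)/LK.
- by move=> L /(subsetP QP)/nP.
- by move=> L /(subsetP QP)/fcP.
- by apply/separatedP => L M x y LQ MQ; apply: (separatedP _ _ sP); apply: (subsetP QP).
- exact: subset_trans nbQB B0K.
- by move=> L /(subsetP QP) LP; apply: disjointWr nbQB (LB L LP).
- move=> L x y LQ xL yK exy; have LP := subsetP QP L LQ.
  have := nbrP L x y LP xL yK exy; rewrite in_setU => /orP[yL|yB].
    by rewrite in_setU yL.
  by rewrite in_setU; apply/orP; right; apply/nbrs_inP; split => //; exists L => //; apply/touchesP; exists x.
- by move=> v /nbrs_inP[].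
- by move=> Q' Q'Q Q'0; rewrite nbin // hall0 // (subset_trans Q'Q).
- exact: cardnb.
- by exists b, b'.
- move=> Q' Q'Q Q'nQ Q'0; rewrite nbin // => tQ' v w vN wN; apply/negP => evw.
  have gQ' : good Q'.
    rewrite /good (subset_trans Q'Q QP) Q'0 tQ' /=.
    by apply/exists_inP; exists v => //; apply/exists_inP; exists w.
  have := minQ Q' gQ'; rewrite leqNgt => /negP; apply.
  by apply: proper_card; rewrite properEneq Q'nQ.
(* In a perfect matching of [K :\ b] the parts in [Q] use up all of [nb Q :\ b], as the sizes agree;
   so the matching restricts to the rest. *)
- have bB := subsetP nbQB b bQ; have [f [fP fL]] := leave b bB.
  have [h [hinj hP]] := inj f b Q QP bB fP fL.
  have hQ : h @: Q = nb Q :\ b.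
    apply/eqP; rewrite eqEcard (card_in_imset hinj); apply/andP; split.
      by apply/subsetP => _ /imsetP[L LQ ->]; have [] := hP L LQ.
    by have := cardsD1 b (nb Q); rewrite bQ cardnb; clear; lia.
  have RX : K :\: cover Q :\: nb Q \subset K :\ b.
    apply/subsetP => x /setDP[/setDP[xK _] xB]; rewrite in_setD1 xK andbT.
    by apply/eqP => xb; rewrite xb bQ in xB.
  apply: (pm_restrict fP RX) => y yR; have [/setD1P[fyb fyK] efy ffy] := fP y (subsetP RX y yR).
  move: yR; rewrite !in_setD fyK andbT => /and3P[yB yQ yK].
  apply/andP; split; apply/negP.
    move=> fyB; have : f y \in h @: Q by rewrite hQ in_setD1 fyb.
    case/imsetP => L LQ ehL; have [_ [x xL ex]] := hP L LQ.
    case/negP: yQ; apply/bigcupP; exists L => //.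
    suff -> : y = x by [].
    have LP := subsetP QP L LQ.
    have xX : x \in K :\ b.
      rewrite !inE (subsetP (LK L LP)) // andbT.
      by apply: contraTneq bB => <-; rewrite (disjointFr (LB L LP) xL).
    by have [_ _ ffx] := fP x xX; rewrite -ffy ehL ex ffx.
  case/bigcupP => L LQ fyL; have LP := subsetP QP L LQ.
  have := nbrP L (f y) y LP fyL yK; rewrite e_sym efy => /(_ isT); rewrite in_setU => /orP[yL|yB0].
    by case/negP: yQ; apply/bigcupP; exists L.
  case/negP: yB; apply/nbrs_inP; split => //; exists L => //.
  by apply/touchesP; exists (f y); rewrite // e_sym.
(* There are at least two parts in [P], so one outside [Q] survives in the rest. *)
- move=> cQ; have [M MP MQ] : exists2 M, M \in P & M \notin Q.
    have /card_gt0P[M] : 0 < #|P :\: Q|.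
      by rewrite cardsD (setIidPr QP) cQ subn_gt0; case: leB0.
    by rewrite inE => /andP[MQ MP]; exists M.
  have /set0Pn[x xM] := nP M MP; apply/set0Pn; exists x.
  rewrite !in_setD (subsetP (LK M MP)) // andbT; apply/andP; split.
    by apply/negP => /(subsetP nbQB); rewrite (disjointFr (LB M MP) xM).
  apply/negP => /bigcupP[L LQ xL].
  have LM : M != L by apply: contraNneq MQ => ->.
  have /trivIsetP/(_ M L MP (subsetP QP L LQ) LM) := tP.
  by move/disjointFr/(_ xM); rewrite xL.
Qed.

End Structure.

(** * Perfect matchings outside one part of an edge barrier *)

Section Main.
Variables (V : finType) (e : rel V).
Hypotheses (e_sym : symmetric e) (e_irr : irreflexive e).
Variables (F : {set {set V}}) (K : {set V}).
Hypothesis obsF : obstructed e F K.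

Section Barrier.
Variables (Q : {set {set V}}) (B : {set V}).
Hypothesis ebQ : edge_barrier e K Q B.
Let nb (Q' : {set {set V}}) := nbrs_in (touches e) B Q'.

(** [B :\ b :\ b'] and [Q :\ K1] have equal size. Hall's condition between them could fail only at a
    family with a single neighbour to spare that loses both [b] and [b'], which the last hypothesis
    excludes. *)
Lemma edge_barrier_pm K1 b b' :
  K1 \in Q -> b \in B -> b' \in B -> b != b' ->
  (forall Q' : {set {set V}}, Q' \subset Q :\ K1 -> Q' != set0 -> #|nb Q'| <= #|Q'|.+1 ->
     ~~ ((b \in nb Q') && (b' \in nb Q'))) ->
  pm e (K :\: K1 :\ b :\ b').
Proof.
move=> K1Q bB b'B bb' notight.
have arith (p q : nat) (x y : bool) : p < x + (y + q) -> (x + (y + q) <= p.+1 -> ~~ (x && y)) -> p <= q.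
  case: (leqP (x + (y + q)) p.+1) => [le lt /(_ isT)|gt _ _]; [move: le lt|move: gt]; clear; case: x; case: y => //=; lia.
have [g [ginj gP]] : exists g : {set V} -> V, {in Q :\ K1 &, injective g} /\
    forall L, L \in Q :\ K1 -> (g L \in B :\ b :\ b') && touches e L (g L).
  apply: hall_in => // Q' Q'Q; have [->|Q'0] := eqVneq Q' set0; first by rewrite cards0.
  have := eb_hall ebQ (subset_trans Q'Q (subsetDl _ _)) Q'0; rewrite -/(nb Q') => lt.
  have -> : nbrs_in (touches e) (B :\ b :\ b') Q' = nb Q' :\ b :\ b'.
    apply/setP => v; rewrite !in_setD1; apply/nbrs_inP/and3P.
      by move=> [/setD1P[-> /setD1P[-> vB]] ex]; split => //; apply/nbrs_inP.
    by move=> [vb' vb /nbrs_inP[vB ex]]; rewrite !in_setD1 vb' vb.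
  have := cardsD1 b (nb Q'); have := cardsD1 b' (nb Q' :\ b).
  rewrite in_setD1 eq_sym bb' /= => e1 e2; have := notight Q' Q'Q Q'0.
  move: lt; rewrite e2 e1; apply: arith.
have cQ : #|Q :\ K1| = #|B :\ b :\ b'|.
  have := cardsD1 K1 Q; have := cardsD1 b B; have := cardsD1 b' (B :\ b).
  rewrite in_setD1 eq_sym bb' b'B bB K1Q (eb_card ebQ) /=; clear; lia.
have gQ : g @: (Q :\ K1) = B :\ b :\ b'.
  apply/eqP; rewrite eqEcard card_in_imset // cQ leqnn andbT.
  by apply/subsetP => _ /imsetP[L LQ ->]; have /andP[] := gP L LQ.
have QB v : v \in cover Q -> v \notin B.
  by case/bigcupP => L LQ vL; rewrite (disjointFr (eb_disj ebQ LQ) vL).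
apply: (pm_cut (Y := K :\: cover Q :\: B)); last 1 first.
- rewrite (_ : _ :\: _ = cover (Q :\ K1) :|: g @: (Q :\ K1)); last first.
    rewrite gQ (coverD1 (eb_triv ebQ) K1Q); apply/setP => v.
    have : (v \in cover Q) ==> (v \notin B) by apply/implyP/QB.
    have : (v \in cover Q) ==> (v \in K).
      by apply/implyP => /bigcupP[L LQ]; apply: (subsetP (eb_sub ebQ LQ)).
    have := subset_implyb v (eb_subB ebQ).
    have : (v \in K1) ==> (v \in cover Q) by apply/implyP => vK1; apply/bigcupP; exists K1.
    rewrite !inE; have [->|_] := eqVneq v b; first by rewrite bB; case: (b \in cover Q); rewrite ?andbF.
    have [->|_] := eqVneq v b'; first by rewrite b'B; case: (b' \in cover Q); rewrite ?andbF.
    by case: (v \in cover Q); case: (v \in B); case: (v \in K1); case: (v \in K).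
  apply: pm_parts => //.
  + by apply: trivIsetS (subsetDl _ _) (eb_triv ebQ).
  + by move=> L /setD1P[_ LQ]; exact: (eb_critical ebQ LQ).
  + move=> L LQ; have /andP[gB ->] := gP L LQ; apply: contraTN gB => gc.
    rewrite !in_setD1 (negbTE (QB (g L) _)) ?andbF //.
    by move: gc; rewrite (coverD1 (eb_triv ebQ) K1Q) inE => /andP[].
- apply/subsetP => v; rewrite !in_setD !in_set1 => /and3P[vB vQ vK].
  rewrite vK andbT; apply/and3P; split; try by apply: contraNneq vB => ->.
  by apply: contra vQ => vK1; apply/bigcupP; exists K1.
- exact: (eb_rest ebQ).
Qed.

Lemma edge_barrier_pm_adj K1 b b' :
  K1 \in Q -> b \in B -> b' \in B -> e b b' -> pm e (K :\: K1 :\ b :\ b').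
Proof.
move=> K1Q bB b'B ebb'; apply: edge_barrier_pm => // [|Q' Q'Q Q'0 tQ'].
  by apply: contraTneq ebb' => ->; rewrite e_irr.
apply/negP => /andP[bN b'N].
have Q'sQ : Q' \subset Q := subset_trans Q'Q (subsetDl _ _).
have Q'nQ : Q' != Q by apply: contraTneq K1Q => <-; apply/negP => /(subsetP Q'Q); rewrite !inE eqxx.
by have := eb_min ebQ Q'sQ Q'nQ Q'0 tQ' bN b'N; rewrite ebb'.
Qed.

(** Call a family without [K1] tight if it has at most one neighbour to spare. Tight families with a
    common neighbour have a tight union, by submodularity. So no tight family touches both [B1] and
    its complement if [B1] is the neighbourhood of a largest tight family touching [b0], or [b0]
    alone if there is none. *)
Lemma edge_barrier_split K1 : K1 \in Q ->
  exists B1 : {set V}, [/\ B1 \subset B, exists2 b, b \in B1 & touches e K1 b,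
    exists2 b, b \in B :\: B1 & touches e K1 b &
    forall b1 b2, b1 \in B1 -> b2 \in B :\: B1 -> pm e (K :\: K1 :\ b1 :\ b2)].
Proof.
move=> K1Q.
have nb1 : 1 < #|nb [set K1]|.
  have := eb_hall ebQ (Q' := [set K1]); rewrite sub1set cards1; apply => //.
  by apply/set0Pn; exists K1; rewrite inE.
have nb1P v : v \in nb [set K1] -> v \in B /\ touches e K1 v.
  by case/nbrs_inP => vB [L]; rewrite inE => /eqP->.
have [b0 b0N] : exists b0, b0 \in nb [set K1] by apply/card_gt0P/ltnW.
have [b0B tb0] := nb1P _ b0N.
pose tight (Q' : {set {set V}}) := [&& Q' \subset Q :\ K1, Q' != set0, #|nb Q'| <= #|Q'|.+1 & b0 \in nb Q'].
have [/existsP[Q0 Q0t]|/existsPn notight] := boolP [exists Q', tight Q'].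
  have [Q' /and4P[Q'Q Q'0 tQ' b0Q'] maxQ'] := arg_maxnP (fun Q' : {set {set V}} => #|Q'|) Q0t.
  exists (nb Q'); split; first by apply/subsetP => v /nbrs_inP[].
  - by exists b0.
  (* If [K1] had all its neighbours in [nb Q'], the family [K1 |: Q'] would violate the strict Hall
     condition. *)
  - apply/exists_inP; apply: contraT => /exists_inPn none.
    have K1Q' : K1 \notin Q' by apply/negP => /(subsetP Q'Q); rewrite !inE eqxx.
    have := eb_hall ebQ (Q' := K1 |: Q'); rewrite cardsU1 K1Q' subUset sub1set K1Q.
    move=> /(_ (subset_trans Q'Q (subsetDl _ _))) h.
    have {}h := h (introT (set0Pn _) (ex_intro _ K1 (setU11 _ _))).
    have := leq_trans h (leq_trans (subset_leq_card _) tQ'); rewrite add1n ltnn => -> //.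
    apply/subsetP => v /nbrs_inP[vB [L /setU1P[->|LQ'] tL]].
      by apply: contraT => vN; have := none v; rewrite inE vN vB tL => /(_ isT).
    by apply/nbrs_inP; split => //; exists L.
  move=> b1 b2 b1N /setDP[b2B b2N]; have /nbrs_inP[b1B _] := b1N.
  apply: edge_barrier_pm => // [|Q2 Q2Q Q20 tQ2]; first by apply: contraNneq b2N => <-.
  apply/negP => /andP[b1N2 b2N2].
  have nbU : nb (Q' :|: Q2) = nb Q' :|: nb Q2.
    apply/setP => v; rewrite in_setU; apply/nbrs_inP/orP.
      move=> [vB [L]]; rewrite in_setU => /orP[LQ|LQ] tL; [left|right]; apply/nbrs_inP; split => //;
      by exists L.
    by case=> /nbrs_inP[vB [L LQ tL]]; split => //; exists L; rewrite // in_setU LQ ?orbT.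
  have sub : nb (Q' :&: Q2) \subset nb Q' :&: nb Q2.
    apply/subsetP => v /nbrs_inP[vB [L /setIP[LQ' LQ2] tL]]; rewrite inE.
    by apply/andP; split; apply/nbrs_inP; split => //; exists L.
  (* For disjoint families the common neighbour [b1] replaces the strict Hall condition. *)
  have le1 : #|Q' :&: Q2| < #|nb Q' :&: nb Q2|.
    have [->|n0] := eqVneq (Q' :&: Q2) set0.
      by rewrite cards0; apply/card_gt0P; exists b1; rewrite inE b1N.
    apply: leq_trans (subset_leq_card sub); apply: (eb_hall ebQ) => //.
    by apply: subset_trans (subsetIl _ _) _; apply: subset_trans Q'Q (subsetDl _ _).
  have tU : tight (Q' :|: Q2).
    apply/and4P; split.
    - by rewrite subUset Q'Q.
    - by case/set0Pn: Q'0 => L LQ'; apply/set0Pn; exists L; rewrite inE LQ'.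
    - have := cardsUI Q' Q2; have := cardsUI (nb Q') (nb Q2); rewrite -nbU.
      by move: le1 tQ' tQ2; clear; lia.
    - by rewrite nbU inE b0Q'.
  have le2 := maxQ' _ tU.
  have eQ : Q' = Q' :|: Q2 by apply/eqP; rewrite eqEcard subsetUl.
  by case/negP: b2N; rewrite eQ nbU inE b2N2 orbT.
exists [set b0]; split; first by rewrite sub1set.
- by exists b0; rewrite ?set11.
- have /card_gt0P[b /setD1P[bb0 bN]] : 0 < #|nb [set K1] :\ b0|.
    by have := cardsD1 b0 (nb [set K1]); rewrite b0N; move: nb1; clear; lia.
  by have [bB tb] := nb1P _ bN; exists b; rewrite // !inE bb0.
move=> b1 b2 /set1P-> /setDP[b2B b2N]; apply: edge_barrier_pm => //.
  by apply: contraNneq b2N => <-; rewrite set11.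
move=> Q2 Q2Q Q20 tQ2; apply/negP => /andP[b0N2 _].
by have := notight Q2; rewrite /tight Q2Q Q20 tQ2 b0N2.
Qed.

Lemma edge_barrier_lobe K1 : K1 \in Q ->
  (forall (e' : rel V) (F' : {set {set V}}) (K' : {set V}), symmetric e' -> irreflexive e' ->
     #|K'| < #|K| -> 1 < #|K'| ->
     factor_critical e' K' -> obstructed e' F' K' -> edge_claim e' F' K') ->
  exists z, certificate z F K1 1.
Proof.
move=> K1Q IH; have [B1 [B1B t1 t2 pm12]] := edge_barrier_split K1Q.
have BK := eb_subB ebQ; have K1K := eb_sub ebQ K1Q; have dK1 := eb_disj ebQ K1Q.
apply: (odd_lobe e_sym e_irr obsF K1K BK dK1 _ _ _ B1B t1 t2 pm12 _ _ _ IH).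
- exact: (eb_neq0 ebQ K1Q).
- exact: (eb_critical ebQ K1Q).
- by move=> x y; apply: (eb_nbr ebQ K1Q).
- by move=> b b' bB b'B; apply: edge_barrier_pm_adj.
- exact: (eb_edge ebQ).
have K1B : #|K1 :|: B| = #|K1| + #|Q|.+1.
  by rewrite cardsU (disjoint_setI0 dK1) cards0 subn0 (eb_card ebQ).
have K1BK : K1 :|: B \subset K by rewrite subUset K1K BK.
(* The contraction has [#|K1|.+2] vertices. This is a decrease because [B] has at least three
   vertices or the rest is nonempty. *)
have [Q1|Q1] := eqVneq #|Q| 1; last first.
  have : 0 < #|Q| by apply/card_gt0P; exists K1.
  by have := subset_leq_card K1BK; rewrite K1B; move: Q1; clear; lia.
have /set0Pn[x] := eb_rest_neq0 ebQ Q1; rewrite !in_setD => /and3P[xB xQ xK].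
have : #|x |: (K1 :|: B)| <= #|K| by apply: subset_leq_card; rewrite subUset sub1set xK.
rewrite cardsU1 K1B Q1 !inE (negbTE xB) orbF.
have -> : (x \in K1) = false by apply: contraNF xQ => xK1; apply/bigcupP; exists K1.
by clear; lia.
Qed.

End Barrier.

End Main.

(** * Existence of certificates *)

Lemma certificate_indicator (V : finType) (S : {set V}) (k : nat) :
  k <= #|S| -> certificate (fun v => (v \in S : nat)%:Z)%R set0 S k.
Proof.
move=> kS; split => [v|v /negbTE-> //|T|]; rewrite ?inE //; first by case: (v \in S).
rewrite /weight (eq_bigr (fun=> 1%R)) => [|v -> //].
by rewrite sumr_const natz lez_nat.
Qed.

Section Step.
Variables (V : finType) (e : rel V).
Hypotheses (e_sym : symmetric e) (e_irr : irreflexive e).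
Variables (F : {set {set V}}) (K : {set V}).
Hypotheses (fcK : factor_critical e K) (obsF : obstructed e F K) (K_gt1 : 1 < #|K|).
Hypothesis IH : forall (e' : rel V) (F' : {set {set V}}) (K' : {set V}),
  symmetric e' -> irreflexive e' -> #|K'| < #|K| -> 1 < #|K'| ->
  factor_critical e' K' -> obstructed e' F' K' -> edge_claim e' F' K' /\ vertex_claim e' F' K'.

(** The building blocks are certificates of total 1 on two sets that are disjoint: two odd parts, or
    the single odd part and the even rest with one vertex of [B]. Each claim selects one of them or
    adds both. *)
Lemma claims_step : [/\ edge_claim e F K, vertex_claim e F K & total_claim F K].
Proof.
have IHe (e' : rel V) (F' : {set {set V}}) (K' : {set V}) : symmetric e' -> irreflexive e' ->
    #|K'| < #|K| -> 1 < #|K'| -> factor_critical e' K' -> obstructed e' F' K' -> edge_claim e' F' K'.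
  by move=> *; apply: (proj1 (IH _ _ _ _ _ _)).
have IHv (e' : rel V) (F' : {set {set V}}) (K' : {set V}) : symmetric e' -> irreflexive e' ->
    #|K'| < #|K| -> 1 < #|K'| -> factor_critical e' K' -> obstructed e' F' K' -> vertex_claim e' F' K'.
  by move=> *; apply: (proj2 (IH _ _ _ _ _ _)).
have K0 : K != set0 by rewrite -card_gt0 ltnW.
have K_gt2 : 2 < #|K|.
  by have := factor_critical_odd e_irr K0 fcK; move: K_gt1; case: #|K| => [|[|[|n]]].
(* Without hyperedges, indicator functions serve as certificates, since the odd number [#|K|] is at
   least 3. *)
have [F0|/set0Pn[T0 T0F]] := eqVneq F set0.
  rewrite F0; split => [x y xK yK exy|u uK|].
  - eexists; apply: (@certificate_indicator _ _ 1).
    have xy : x != y by apply: contraTneq exy => ->; rewrite e_irr.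
    have sub : [set x; y] \subset K by rewrite subUset !sub1set xK.
    by rewrite cardsD (setIidPr sub) cards2 xy subn_gt0.
  - eexists; left; apply: (@certificate_indicator _ _ 2).
    by have := cardsD1 u K; rewrite uK; move: K_gt2; clear; lia.
  - by eexists; apply: (@certificate_indicator _ _ 2); apply: ltnW.
have [Q [B ebQ]] := edge_barrier_exists e_sym e_irr fcK obsF T0F.
have [b [b' [bB b'B ebb']]] := eb_edge ebQ.
have lobe K1 : K1 \in Q -> exists z, certificate z F K1 1.
  by move=> K1Q; apply: (edge_barrier_lobe e_sym e_irr obsF ebQ K1Q IHe).
have Q0 : 0 < #|Q| by apply/card_gt0P; have [L LQ _] := eb_touch ebQ bB; exists L.
have [Q1|Q1] := ltnP 1 #|Q|.
  have [K1 K1Q] : exists K1, K1 \in Q by apply/card_gt0P.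
  have /card_gt0P[K2 /setD1P[K21 K2Q]] : 0 < #|Q :\ K1|.
    by have := cardsD1 K1 Q; rewrite K1Q; move: Q1; clear; lia.
  have [z1 z1P] := lobe K1 K1Q; have [z2 z2P] := lobe K2 K2Q.
  have K1K := eb_sub ebQ K1Q; have K2K := eb_sub ebQ K2Q.
  have d12 : [disjoint K1 & K2] by apply: (trivIsetP (eb_triv ebQ)); rewrite // eq_sym.
  have sep x y : x \in K1 -> y \in K2 -> e x y = false.
    by move=> xK yK; apply/negbTE; apply: (separatedP _ _ (eb_sep ebQ) K1 K2); rewrite // eq_sym.
  have z12 := certificateU d12 z1P z2P.
  split => [x y xK yK exy|u uK|].
  (* An edge cannot meet both [K1] and [K2], so one of the two certificates avoids it. *)
  - have [/existsP[v /andP[vK1]]|] := boolP [exists v, (v \in K1) && (v \in [set x; y])].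
      move=> vxy; exists z2; apply: certificateW z2P; rewrite subsetD K2K /=.
      rewrite -setI_eq0; apply/eqP/setP => w; rewrite in_setI in_set0; apply/negP => /andP[wK2 wxy].
      have vw : v != w by apply: contraTneq wK2 => <-; rewrite (disjointFr d12 vK1).
      have : e v w.
        move: vxy wxy vw; rewrite !inE => /orP[]/eqP-> /orP[]/eqP->; rewrite ?eqxx // => _.
        by rewrite e_sym.
      by rewrite sep.
    move=> none; exists z1; apply: certificateW z1P; rewrite subsetD K1K /=.
    rewrite -setI_eq0; apply/eqP/setP => w; rewrite in_setI in_set0; apply/negP => wP.
    by case/existsP: none; exists w.
  (* If [u] lies in one of the parts, the certificate of the other vanishes on all neighbours of
     [u]; if [u] lies in neither, the sum avoids [u]. *)
  - have away L z : L \in Q -> certificate z F L 1 -> u \notin L -> ~~ touches e L u ->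
        certificate z F (K :\ u) 1 /\ forall v, v \in K -> e u v -> (z v <= 0)%R.
      move=> LQ zP uL tL; split.
        apply: certificateW zP; rewrite subsetD1 uL andbT; exact: (eb_sub ebQ LQ).
      move=> v vK euv; case: zP => _ z0 _ _; rewrite z0 //.
      by apply: contra tL => vL; apply/touchesP; exists v; rewrite // e_sym.
    have [uK1|uK1] := boolP (u \in K1).
      exists z2; right; apply: (away K2) => //; first by rewrite (disjointFr d12 uK1).
      by apply/touchesP => -[y yK2]; rewrite e_sym sep.
    have [uK2|uK2] := boolP (u \in K2).
      by exists z1; right; apply: (away K1) => //; apply/touchesP => -[y yK1]; rewrite sep.
    exists (fun v => z1 v + z2 v)%R; left; apply: certificateW z12.
    by rewrite subUset !subsetD1 K1K K2K uK1.
  - by exists (fun v => z1 v + z2 v)%R; apply: certificateW z12; rewrite subUset K1K.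
have cQ : #|Q| = 1 by apply/eqP; rewrite eqn_leq Q1.
have /eqP/cards1P[K1 eQ] := cQ; have K1Q : K1 \in Q by rewrite eQ set11.
have bb' : b != b' by apply: contraTneq ebb' => ->; rewrite e_irr.
have eB : B = [set b; b'].
  apply/esym/eqP; rewrite eqEcard (eb_card ebQ) cQ cards2 bb' andbT.
  by rewrite subUset !sub1set bB.
have K1K := eb_sub ebQ K1Q; have dK1B := eb_disj ebQ K1Q.
have covQ : cover Q = K1 by rewrite eQ cover1.
pose R := K :\: K1 :\ b :\ b'.
have eR : K :\: cover Q :\: B = R.
  by rewrite covQ eB /R; apply/setP => v; rewrite !inE negb_or; case: (v == b); case: (v == b').
have [z1 z1P] := lobe K1 K1Q.
have outB c : c \in B -> c \in K :\: K1.
  by move=> cB; rewrite inE (subsetP (eb_subB ebQ)) // andbT (disjointFl dK1B cB).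
have zR c : c \in [set b; b'] -> exists z, certificate z F (c |: R) 1 /\ (z c <= 0)%R.
  have tB x : x \in B -> touches e K1 x.
    by case/(eb_touch ebQ) => L; rewrite eQ => /set1P->.
  apply: (even_lobe e_sym e_irr fcK obsF K1K); rewrite ?outB ?tB -/R -?eR //.
  - exact: (eb_neq0 ebQ K1Q).
  - exact: (eb_critical ebQ K1Q).
  - by move=> x y xK1 yK exy; rewrite -eB; apply: (eb_nbr ebQ K1Q xK1).
  - exact: (eb_rest_neq0 ebQ cQ).
  - exact: (eb_rest ebQ).
have K1c c : c \in [set b; b'] -> c \notin K1 by rewrite -eB => /outB/setDP[].
have cK c : c \in [set b; b'] -> c \in K by rewrite -eB => /outB/setDP[].
have RK : R \subset K by apply/subsetP => v; rewrite !inE => /and4P[].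
have RK1 v : v \in R -> v \notin K1 by rewrite !inE => /and4P[].
have Rb c : c \in [set b; b'] -> c \notin R.
  by rewrite !inE => /orP[]/eqP->; rewrite eqxx ?andbF.
have dc c : c \in [set b; b'] -> [disjoint K1 & c |: R].
  move=> cb; rewrite -setI_eq0; apply/eqP/setP => v; rewrite in_setI in_setU1 in_set0.
  by apply/negP => /andP[vK /orP[/eqP vc|/RK1]]; [move: (K1c c cb); rewrite -vc|]; rewrite vK.
have nK1R x y : x \in K1 -> y \in R -> e x y = false.
  move=> xK yR; apply/negP => exy; have := eb_nbr ebQ K1Q xK (subsetP RK y yR) exy.
  by rewrite in_setU (negbTE (RK1 y yR)) eB /= => /Rb; rewrite yR.
split => [x y xK yK exy|u uK|].
(* An edge with an end in [K1] has its other end in [K1] or [B]; if [c] is a vertex of [B] off the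
   edge, [c |: R] avoids it. *)
- have xy : x != y by apply: contraTneq exy => ->; rewrite e_irr.
  have [x1|x1] := boolP (x \in K1); last have [y1|y1] := boolP (y \in K1); last first.
  + exists z1; apply: certificateW z1P; rewrite subsetD K1K /=.
    rewrite -setI_eq0; apply/eqP/setP => w; rewrite !inE; apply/negP => /andP[wK /orP[]/eqP wx].
      by rewrite -wx wK in x1.
    by rewrite -wx wK in y1.
  + have := eb_nbr ebQ K1Q y1 xK; rewrite e_sym exy => /(_ isT); rewrite in_setU (negbTE x1) /= => xB.
    have [c [cb cx]] : exists c, c \in [set b; b'] /\ c != x.
      have [bx|bx] := eqVneq b x; last by exists b; rewrite !inE eqxx.
      by exists b'; rewrite !inE eqxx orbT -bx eq_sym.
    have [z [zP _]] := zR c cb; exists z; apply: certificateW zP.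
    rewrite subsetD subUset sub1set cK //= RK /=.
    rewrite -setI_eq0; apply/eqP/setP => w; rewrite in_setI in_setU1 in_set2 in_set0.
    apply/negP => /andP[/orP[/eqP->|wR] /orP[/eqP wx|/eqP wy]].
    * by rewrite wx eqxx in cx.
    * by move: (K1c c cb); rewrite wy y1.
    * by move: (Rb x); rewrite -eB xB -wx wR => /(_ isT).
    * by move: (RK1 w wR); rewrite wy y1.
  + have [c [cb cy]] : exists c, c \in [set b; b'] /\ c != y.
      have [bx|bx] := eqVneq b y; last by exists b; rewrite !inE eqxx.
      by exists b'; rewrite !inE eqxx orbT -bx eq_sym.
    have yR : y \notin R by apply: contraTN exy => yR; rewrite nK1R.
    have [z [zP _]] := zR c cb; exists z; apply: certificateW zP.
    rewrite subsetD subUset sub1set cK //= RK /=.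
    rewrite -setI_eq0; apply/eqP/setP => w; rewrite in_setI in_setU1 in_set2 in_set0.
    apply/negP => /andP[/orP[/eqP->|wR] /orP[/eqP wx|/eqP wy]].
    * by move: (K1c c cb); rewrite wx x1.
    * by rewrite wy eqxx in cy.
    * by move: (RK1 w wR); rewrite wx x1.
    * by rewrite -wy wR in yR.
(* For [u] in [K1], the only possible neighbour in [b |: R] is [b], where [z b <= 0]. For [u] in
   [B], the sum with the other vertex of [B] avoids [u]. For [u] in [R], no neighbour lies in
   [K1]. *)
- have [uK1|uK1] := boolP (u \in K1).
    have bb : b \in [set b; b'] by rewrite !inE eqxx.
    have [z [zP zb]] := zR b bb; exists z; right; split.
      apply: certificateW zP; rewrite subsetD1 subUset sub1set cK // RK in_setU1 /= negb_or.
      apply/andP; split; first by apply: contraTneq uK1 => ->; apply: K1c.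
      by apply: contraTN uK1; apply: RK1.
    move=> v vK euv; have [->//|vb] := eqVneq v b; case: zP => _ z0 _ _; rewrite z0 //.
    by rewrite in_setU1 negb_or vb; apply: contraTN euv => vR; rewrite nK1R.
  have [uB|uB] := boolP (u \in [set b; b']).
    have [c [cb cu]] : exists c, c \in [set b; b'] /\ c != u.
      have [bx|bx] := eqVneq b u; last by exists b; rewrite !inE eqxx.
      by exists b'; rewrite !inE eqxx orbT -bx eq_sym.
    have [z [zP _]] := zR c cb; exists (fun v => z1 v + z v)%R; left.
    apply: certificateW (certificateU (dc c cb) z1P zP).
    by rewrite subsetD1 !subUset sub1set K1K cK // RK in_setU in_setU1 (negbTE uK1) (negbTE (Rb u uB)) eq_sym (negbTE cu).
  exists z1; right; split; first by apply: certificateW z1P; rewrite subsetD1 K1K.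
  have uR : u \in R by move: uB; rewrite !inE uK uK1 negb_or => /andP[-> ->].
  move=> v vK euv; case: z1P => _ z0 _ _; rewrite z0 //.
  by apply: contraTN euv => vK1; rewrite e_sym nK1R.
have bb : b \in [set b; b'] by rewrite !inE eqxx.
have [z [zP _]] := zR b bb; exists (fun v => z1 v + z v)%R.
apply: certificateW (certificateU (dc b bb) z1P zP).
by rewrite !subUset sub1set K1K cK.
Qed.

End Step.

Theorem critical_certificates (V : finType) (e : rel V) (F : {set {set V}}) (K : {set V}) :
  symmetric e -> irreflexive e -> factor_critical e K -> obstructed e F K -> 1 < #|K| ->
  [/\ edge_claim e F K, vertex_claim e F K & total_claim F K].
Proof.
have [n] := ubnP #|K|; elim: n e F K => // n IHn e F K leK e_sym e_irr fcK obsF K_gt1.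
apply: claims_step => // e' F' K' sym' irr' ltK K'_gt1 fcK' obsF'.
by have [] := IHn e' F' K' (leq_trans ltK leK) sym' irr' fcK' obsF' K'_gt1.
Qed.

(** * The upper bound *)

Section UpperBound.
Variables (V : finType) (E : {set {set V}}).
Hypothesis (uniE : forall T, T \in E -> #|T| = 3).
Implicit Types (X Y K T : {set V}) (C P : {set {set V}}).

Definition shadow (x y : V) := (x != y) && [exists T in E, (x \in T) && (y \in T)].

Lemma shadow_sym : symmetric shadow.
Proof.
by move=> x y; rewrite /shadow eq_sym; congr (_ && _); apply: eq_existsb => T; rewrite [X in _ && X]andbC.
Qed.

Lemma shadow_irr : irreflexive shadow.
Proof. by move=> x; rewrite /shadow eqxx. Qed.

Lemma shadow_edge T x y : T \in E -> x \in T -> y \in T -> x != y -> shadow x y.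
Proof. by move=> TE xT yT xy; rewrite /shadow xy; apply/exists_inP; exists T; rewrite ?xT. Qed.

(** This property adds up over disjoint sets, so a partition into sets of size 2 or 3 inside edges
    is enough. *)
Definition half_coverable X :=
  exists C, [/\ C \subset E, X \subset cover C & 2 * #|C| <= #|X|].

Lemma half_coverable0 : half_coverable set0.
Proof. by exists set0; rewrite !sub0set !cards0. Qed.

Lemma half_coverableU X Y :
  [disjoint X & Y] -> half_coverable X -> half_coverable Y -> half_coverable (X :|: Y).
Proof.
move=> dXY [C [CE XC cC]] [D [DE YD cD]]; exists (C :|: D); split.
- by rewrite subUset CE.
- by rewrite /cover bigcup_setU setUSS.
rewrite [X in _ <= X]cardsU (disjoint_setI0 dXY) cards0 subn0.
by apply: leq_trans (leq_add cC cD); rewrite -mulnDr leq_mul2l leq_card_setU.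
Qed.

Lemma half_coverable_edge T X : T \in E -> X \subset T -> 1 < #|X| -> half_coverable X.
Proof.
by move=> TE XT X1; exists [set T]; rewrite sub1set TE cover1 cards1.
Qed.

Lemma half_coverable_pm X : pm shadow X -> half_coverable X.
Proof.
have [n] := ubnP #|X|; elim: n X => // n IHn X leX /pmP[f fP].
have [->|/set0Pn[x xX]] := eqVneq X set0; first exact: half_coverable0.
have [fxX exf ffx] := fP x xX.
have sub : [set x; f x] \subset X by rewrite subUset !sub1set xX.
rewrite -(setID X [set x; f x]) (setIidPr sub); apply: half_coverableU.
- by rewrite -setI_eq0; apply/eqP/setP => y; rewrite !inE; case: eqP; case: eqP.
- have /andP[xfx /exists_inP[T TE /andP[xT fxT]]] := exf.
  by apply: (half_coverable_edge TE); rewrite ?subUset ?sub1set ?xT // cards2 xfx.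
apply: IHn.
  have := cardsID [set x; f x] X; rewrite (setIidPr sub) cards2.
  by move: leX; clear; lia.
apply: (pm_restrict fP (subsetDl _ _)) => y /setDP[yX]; rewrite !inE negb_or => /andP[yx yfx].
have [fyX _ ffy] := fP y yX; rewrite fyX andbT negb_or; apply/andP; split.
  by apply: contraNneq yfx => <-; rewrite ffy.
by apply: contraNneq yx => eqf; rewrite -ffy eqf ffx.
Qed.

Definition packable K := [exists T in E, (T \subset K) && pm shadow (K :\: T)].

Lemma half_coverable_packable K : packable K -> half_coverable K.
Proof.
case/exists_inP => T TE /andP[TK pmT].
rewrite -(setID K T) (setIidPr TK); apply: half_coverableU.
- by rewrite -setI_eq0; apply/eqP/setP => y; rewrite !inE; case: (y \in T); rewrite ?andbF.
- by apply: (half_coverable_edge TE); rewrite // uniE.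
- exact: half_coverable_pm.
Qed.

(** A singleton gets weight 2, which is affordable because an edge through it has two further
    vertices, each to be given weight -2. *)
Lemma unpackable_certificate K :
  K != set0 -> factor_critical shadow K -> ~~ packable K ->
  exists z : V -> int, [/\ forall v, (z v <= (if (1 < #|K|)%N then 1 else 2))%R,
    forall v, v \notin K -> z v = 0%R,
    forall T, T \in E -> T \subset K -> (weight z T <= 0)%R & (2 <= weight z K)%R].
Proof.
move=> K0 fcK npK; case: ifP => K1.
  have obsK : obstructed shadow [set T in E | T \subset K] K.
    move=> T; rewrite inE => /andP[TE TK]; split => //; first exact: uniE.
      by move=> x y xT yT; apply: shadow_edge TE xT yT.
    by apply: contra npK => pmT; apply/exists_inP; exists T; rewrite ?TK.
  have [_ _ [z [le1 z0 zF zK]]] := critical_certificates shadow_sym shadow_irr fcK obsK K1.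
  by exists z; split => // T TE TK; apply: zF; rewrite inE TE.
have cK : #|K| == 1 by rewrite eqn_leq leqNgt K1 card_gt0.
have /cards1P[x ->] := cK; exists (fun v => if v == x then 2 else 0)%R; split.
- by move=> v; case: ifP.
- by move=> v; rewrite inE => /negbTE->.
- by move=> T TE /subset_leq_card; rewrite uniE // cards1.
- by rewrite weight1 eqxx.
Qed.

Variable d : nat.
Hypotheses (d_gt0 : 0 < d) (regE : forall v, degree E v = d).

(** Summed over all edges, the weights count every vertex [d] times. *)
Lemma weight_setT_le0 (z : V -> int) :
  (forall T, T \in E -> weight z T <= 0)%R -> (weight z setT <= 0)%R.
Proof.
move=> zE; have : (\sum_(T in E) weight z T <= 0)%R by apply: sumr_le0.
rewrite /weight (exchange_big_dep predT) //=.
have -> : (\sum_v \sum_(T in E | v \in T) z v = (weight z setT) *+ d)%R.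
  rewrite /weight -sumrMnl; apply: eq_big => [v|v _]; first by rewrite inE.
  rewrite sumr_const -(regE v); congr (_ *+ _)%R; apply: eq_card => T; by rewrite !inE.
by rewrite pmulrn_lle0.
Qed.

(** Certificates on the parts in [Q] and weight -2 on [A'] make every edge nonpositive. By
    regularity the total, which is at least [2 * #|Q| - 2 * #|A'|], is nonpositive too. *)
Lemma unpackable_hall A P (Q : {set {set V}}) :
  barrier shadow setT A P -> {in P, forall L, factor_critical shadow L} ->
  Q \subset P -> {in Q, forall L, ~~ packable L} ->
  #|Q| <= #|nbrs_in (touches shadow) A Q|.
Proof.
case/and3P => _ pP sP fcP QP badQ; set A' := nbrs_in _ _ _.
have tP := partition_trivIset pP; have cP := cover_partition pP.
have tQ := trivIsetS QP tP.
have /fin_all_exists[zz zzP] : forall L : {set V}, exists z : V -> int, L \in Q ->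
    [/\ forall v, (z v <= (if (1 < #|L|)%N then 1 else 2))%R,
    forall v, v \notin L -> z v = 0%R,
    forall T, T \in E -> T \subset L -> (weight z T <= 0)%R & (2 <= weight z L)%R].
  move=> L; have [LQ|] := boolP (L \in Q); last by exists (fun=> 0%R).
  have LP := subsetP QP L LQ.
  have [z zP] := unpackable_certificate (partition_neq0 pP LP) (fcP L LP) (badQ L LQ).
  by exists z.
pose Z v : int := if v \in cover Q then zz (pblock Q v) v else if v \in A' then (- 2%:Z)%R else 0%R.
have A'A : A' \subset A by apply/subsetP => v /nbrs_inP[].
have coverA v : v \in cover Q -> v \notin A.
  case/bigcupP => L LQ vL; have := subsetP (partitionS pP (subsetP QP L LQ)) v vL.
  by rewrite !inE andbT.
have ZL L v : L \in Q -> v \in L -> Z v = zz L v.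
  move=> LQ vL; rewrite /Z (_ : v \in cover Q); last by apply/bigcupP; exists L.
  by rewrite (def_pblock tQ LQ vL).
have ZA v : v \in A' -> Z v = (- 2%:Z)%R.
  move=> vA'; rewrite /Z vA' ifN //; apply: contraTN (subsetP A'A v vA'); exact: coverA.
have Zout v : v \notin cover Q -> (Z v <= 0)%R.
  by move=> vQ; rewrite /Z (negbTE vQ); case: ifP.
have sumA' X : X \subset A' -> weight Z X = (- (2 * #|X|)%:Z)%R.
  move=> XA; rewrite /weight (eq_bigr (fun=> (- 2%:Z)%R)) => [|v /(subsetP XA)/ZA //].
  by rewrite sumr_const -mulr_natr natz; clear; lia.
have ZE T : T \in E -> (weight Z T <= 0)%R.
  move=> TE; have [T0|/set0Pn[x /setIP[xT xQ]]] := eqVneq (T :&: cover Q) set0.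
    apply: sumr_le0 => v vT; apply: Zout; apply/negP => vQ.
    by have /setP/(_ v) := T0; rewrite !inE vT vQ.
  have /bigcupP[L LQ xL] := xQ; have LP := subsetP QP L LQ.
  have [le1 z0 zT _] := zzP L LQ.
  have TL : T :\: L \subset A'.
    apply/subsetP => y /setDP[yT yL].
    have exy : shadow x y by apply: shadow_edge TE xT yT _; apply: contraNneq yL => <-.
    have yA : y \in A.
      apply: contraT => yA; have : y \in cover P by rewrite cP !inE yA.
      case/bigcupP => M MP yM; have LM : L != M by apply: contraNneq yL => ->.
      by have := separatedP _ _ sP L M x y LP MP LM xL yM; rewrite exy.
    apply/nbrs_inP; split => //; exists L => //; apply/touchesP; by exists x.
  rewrite (weightID Z T L) (sumA' _ TL).
  have -> : weight Z (T :&: L) = weight (zz L) (T :&: L).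
    by apply: eq_weight => v /setIP[_ vL]; apply: ZL.
  have [TL0|TL0] := eqVneq (T :\: L) set0.
    have TsL : T \subset L by rewrite -setD_eq0 TL0.
    by rewrite TL0 cards0 (setIidPl TsL) muln0 subr0; apply: zT.
  have c1 : 0 < #|T :\: L| by rewrite card_gt0.
  have c3 := cardsID L T; rewrite (uniE TE) in c3.
  have cL := subset_leq_card (subsetIr T L).
  have : (weight (zz L) (T :&: L) <= (if (1 < #|L|)%N then 1 else 2) *+ #|T :&: L|)%R.
    by rewrite -sumr_const; apply: ler_sum.
  (* An edge has [t] vertices in [L] and [u > 0] in [A']. If [L] has more than one vertex, the
     weight is at most [t - 2 * u] with [t <= 2]; if [L] is a singleton, [t <= 1] and [u >= 2]. *)
  have arith (w : int) (l t u : nat) :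
      0 < u -> t + u = 3 -> t <= l ->
      (w <= (if (1 < l)%N then 1 else 2) * t%:R)%R -> (w + - (2 * u)%:Z <= 0)%R.
    by clear; rewrite (natz t); case: (ltnP 1 l) => l1; lia.
  by rewrite -mulr_natr; apply: arith.
have := weight_setT_le0 ZE.
have -> : weight Z setT = (weight Z A' + weight Z (cover Q) )%R.
  rewrite (weightID Z setT A') setTI (weightID Z (setT :\: A') (cover Q)).
  rewrite [X in (_ + (_ + X))%R]weight_eq0 ?addr0 => [|v]; last first.
    by rewrite !in_setD in_setT andbT /Z => /andP[/negbTE-> /negbTE->].
  congr (_ + weight _ _)%R; apply/setP => v; rewrite in_setI in_setD in_setT andbT.
  case: (boolP (v \in cover Q)) => [vQ|_]; rewrite ?andbF //= andbT.
  by apply/negP => /(subsetP A'A); apply/negP/coverA.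
have -> : weight Z (cover Q) = (\sum_(L in Q) weight Z L)%R by apply: big_trivIset.
rewrite (sumA' _ (subxx _)).
have : (\sum_(L in Q) 2%:Z <= \sum_(L in Q) weight Z L)%R.
  apply: ler_sum => L LQ; have [_ _ _] := zzP L LQ.
  by rewrite (@eq_weight _ Z (zz L)) // => v; apply: ZL.
rewrite sumr_const.
move: #|Q| #|A'| (\sum_(L in Q) _)%R => q a s; clear; lia.
Qed.

(** If parts outnumber [A], Hall's theorem assigns to each part a touching vertex of [A] or, if it
    is packable, a dummy. By counting, all of [A] is used, so the enlarged parts partition the
    vertex set. *)
Theorem half_coverable_regular : half_coverable [set: V].
Proof.
have [A [P [bAP fcP hallA]]] := tutte_strong shadow_sym shadow_irr [set: V].
have /and3P[_ pP _] := bAP.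
have [leP|ltAP] := leqP #|P| #|A|.
  exact: half_coverable_pm (pm_barrier shadow_sym shadow_irr bAP fcP hallA leP).
have [L0 L0P] : exists L0, L0 \in P by apply/card_gt0P; apply: leq_ltn_trans ltAP.
have [v0 _] : exists v0, v0 \in L0 by apply/set0Pn; apply: partition_neq0 pP L0P.
pose N := #|P| - #|A|.
pose r (L : {set V}) (j : V + 'I_N) :=
  match j with inl a => (a \in A) && touches shadow L a | inr _ => packable L end.
(* The [N] dummies can be matched to packable parts only. *)
have [g [ginj gP]] : exists g : {set V} -> V + 'I_N, {in P &, injective g} /\
    forall L, L \in P -> r L (g L).
  apply: (hall (inl v0)) => S SP.
  have inlS : inl @: nbrs_in (touches shadow) A S \subset [set j | [exists L in S, r L j]].
    apply/subsetP => _ /imsetP[a /nbrs_inP[aA [L LS tL]] ->]; rewrite inE.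
    by apply/exists_inP; exists L => //; rewrite /r aA.
  have inl_inj : injective (@inl V 'I_N) by move=> ? ? [].
  have inr_inj : injective (@inr V 'I_N) by move=> ? ? [].
  have [/forall_inP bad|/forall_inPn[L LS pL]] := boolP [forall L in S, ~~ packable L].
    apply: leq_trans (unpackable_hall bAP fcP SP bad) _.
    by rewrite -(card_imset _ inl_inj); apply: subset_leq_card.
  have inrS : inr @: [set: 'I_N] \subset [set j | [exists L in S, r L j]].
    apply/subsetP => _ /imsetP[i _ ->]; rewrite inE; apply/exists_inP; exists L => //=.
    by rewrite negbK in pL.
  apply: leq_trans (subset_leq_card (_ : inl @: nbrs_in (touches shadow) A S :|: inr @: [set: 'I_N] \subset _)); last by rewrite subUset inlS.
  rewrite cardsU (_ : _ :&: _ = set0); last first.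
    by apply/setP => j; rewrite !inE; apply/negP => /andP[/imsetP[a _ ->] /imsetP[]].
  rewrite cards0 subn0 !card_imset // cardsT card_ord.
  (* A family [S] with a packable part sees all dummies. The vertices of [A] that do not touch [S]
     inject into the parts outside [S], which bounds their number. *)
  have := hallA (A :\: nbrs_in (touches shadow) A S) (subsetDl _ _).
  have NA : nbrs_in (touches shadow) A S \subset A by apply/subsetP => a /nbrs_inP[].
  rewrite cardsD (setIidPr NA) => le1.
  have le2 : #|nbrs_in (fun a L => touches shadow L a) P (A :\: nbrs_in (touches shadow) A S)| <= #|P :\: S|.
    apply/subset_leq_card/subsetP => M /nbrs_inP[MP [a /setDP[aA aN] tM]].
    by rewrite inE MP andbT; apply: contra aN => MS; apply/nbrs_inP; split => //; exists M.
  have := subset_leq_card NA; have := subset_leq_card SP.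
  rewrite cardsD (setIidPr SP) in le2; move: le1 le2 ltAP; rewrite /N.
  move: #|nbrs_in _ P _| #|nbrs_in _ A _| #|P| #|A| #|S| => *; lia.
have gA a : a \in A -> exists2 L, L \in P & g L = inl a.
  move=> aA.
  have gPe : g @: P = inl @: A :|: inr @: [set: 'I_N].
    apply/eqP; rewrite eqEcard; apply/andP; split.
      apply/subsetP => _ /imsetP[L LP ->]; have := gP L LP; rewrite inE.
      case: (g L) => [x /andP[xA _]|i _]; first by rewrite imset_f.
      by rewrite orbC imset_f.
    rewrite (card_in_imset ginj); apply: leq_trans (leq_card_setU _ _) _.
    rewrite !card_imset ?cardsT ?card_ord => [| ? ? [] // | ? ? [] //].
    by rewrite subnKC // ltnW.
  have : inl a \in g @: P by rewrite gPe inE imset_f.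
  by case/imsetP => L LP ->; exists L.
pose part (L : {set V}) := if g L is inl a then a |: L else L.
have -> : [set: V] = \bigcup_(L in P) part L.
  apply/esym/eqP; rewrite -subTset; apply/subsetP => v _; apply/bigcupP.
  have [vA|vA] := boolP (v \in A).
    by have [L LP gL] := gA v vA; exists L => //; rewrite /part gL setU11.
  have : v \in cover P by rewrite (cover_partition pP) !inE vA.
  case/bigcupP => L LP vL; exists L => //; rewrite /part; case: (g L) => // a.
  by rewrite inE vL orbT.
have LA L a : L \in P -> a \in A -> a \notin L.
  by move=> LP aA; apply/negP => /(subsetP (partitionS pP LP)); rewrite inE aA.
apply: bigcup_set_ind => [|||L M LP MP LM].
- exact: half_coverable0.
- exact: half_coverableU.
- move=> L LP; have := gP L LP; rewrite /part; case: (g L) => [a /= /andP[aA tL]|i /=].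
    apply: half_coverable_pm; apply: (pm_attach shadow_sym shadow_irr) => //; first exact: fcP.
    exact: LA.
  exact: half_coverable_packable.
rewrite -setI_eq0; apply/eqP/setP => v; rewrite in_setI in_set0; apply/negP => /andP[].
have partP (L' : {set V}) : L' \in P -> v \in part L' -> (v \in L') \/ (v \in A /\ g L' = inl v).
  move=> L'P; have := gP L' L'P; rewrite /part; case: (g L') => [a /= /andP[aA _]|i _]; last by left.
  by case/setU1P => [->|]; [right|left].
move=> /(partP L LP)[vL|[vA gL]] /(partP M MP)[vM|[vA' gM]].
- have /trivIsetP/(_ L M LP MP LM) := partition_trivIset pP.
  by move/disjointFr/(_ vL); rewrite vM.
- by have := LA L v LP vA'; rewrite vL.
- by have := LA M v MP vA; rewrite vM.
- by have /eqP := ginj L M LP MP (etrans gL (esym gM)); rewrite (negbTE LM).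
Qed.

End UpperBound.

Lemma rho_min (V : finType) (E C : {set {set V}}) :
  edge_cover E E -> edge_cover E C -> rho E <= #|C|.
Proof. by move=> cE cC; rewrite /rho; case: arg_minnP => // D _ /(_ C cC). Qed.

Lemma rho_attained (V : finType) (E : {set {set V}}) :
  edge_cover E E -> exists2 C, edge_cover E C & rho E = #|C|.
Proof. by move=> cE; rewrite /rho; case: arg_minnP => // C cC _; exists C. Qed.

Lemma hypergraph_edge_cover (V : finType) (E : {set {set V}}) :
  is_hypergraph E -> edge_cover E E.
Proof. by case/and3P => _ _ cE; rewrite /edge_cover subxx. Qed.

Lemma regularP (V : finType) (E : {set {set V}}) :
  is_hypergraph E -> regular E -> exists2 d, 0 < d & forall v, degree E v = d.
Proof.
case/and3P => /card_gt0P[v0 _] _ /eqP cE /forallP regE; exists (degree E v0).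
  have : v0 \in cover E by rewrite cE inE.
  by case/bigcupP => T TE vT; apply/card_gt0P; exists T; rewrite inE TE.
by move=> v; apply/eqP; have /forallP := regE v; apply.
Qed.

Theorem double_rho_le (V : finType) (E : {set {set V}}) :
  is_hypergraph E -> uniform 3 E -> regular E -> 2 * rho E <= #|V|.
Proof.
move=> hE /forall_inP uniE regE; have [d d0 degd] := regularP hE regE.
have [|C [CE VC leC]] := @half_coverable_regular V E _ d d0 degd.
  by move=> T TE; apply/eqP/uniE.
rewrite cardsT in leC; apply: leq_trans leC; rewrite leq_mul2l /=.
apply: rho_min; first exact: hypergraph_edge_cover.
by rewrite /edge_cover CE -subTset.
Qed.

(** * Disjoint complete 3-graphs *)

Section DisjointK4.
Variables n k : nat.
Hypotheses (k_gt0 : 0 < k) (n4k : n = 4 * k).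

Definition block (u : 'I_n) := [set i : 'I_n | i %/ 4 == u %/ 4].

(** Each edge is indexed by the one vertex of its block that it omits. *)
Definition disjoint_K4 := [set block u :\ u | u : 'I_n].

Lemma block_refl u : u \in block u. Proof. by rewrite inE. Qed.

Lemma block_eq u v : u \in block v -> block u = block v.
Proof. by rewrite inE => /eqP uv; apply/setP => i; rewrite !inE uv. Qed.

Lemma block_sym u v : (u \in block v) = (v \in block u).
Proof. by rewrite !inE eq_sym. Qed.

Lemma card_block u : #|block u| = 4.
Proof.
have lt (j : 'I_4) : u %/ 4 * 4 + j < n.
  have arith (a b m : nat) : a < m -> b < 4 -> m = 4 * k -> a %/ 4 * 4 + b < m by clear; lia.
  exact: arith (ltn_ord u) (ltn_ord j) n4k.
have inj : injective (fun j => Ordinal (lt j)).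
  by move=> i j /(congr1 val) /= /addnI/val_inj.
rewrite -[RHS](card_ord 4) -cardsT -(card_imset _ inj); apply: eq_card => i.
rewrite inE; apply/eqP/imsetP => [eqi|[j _ ->]] /=.
  exists (Ordinal (ltn_pmod i (isT : 0 < 4))); rewrite ?inE //.
  by apply: val_inj; rewrite /= -eqi -divn_eq.
by rewrite divnMDl // (divn_small (ltn_ord j)) addn0.
Qed.

Lemma blockD1_inj : injective (fun u => block u :\ u).
Proof.
move=> u w /= eqb; have /card_gt0P[x xu] : 0 < #|block u :\ u|.
  by have := cardsD1 u (block u); rewrite card_block block_refl; clear; lia.
have uw : block u = block w.
  have /setD1P[_ xbu] := xu; have : x \in block w :\ w by rewrite -eqb.
  by case/setD1P => _ /block_eq <-; rewrite (block_eq xbu).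
apply/eqP; apply: contraT => nuw; have : u \in block w :\ w by rewrite in_setD1 nuw -uw block_refl.
by rewrite -eqb !inE eqxx.
Qed.

Lemma card_blockD1 u : #|block u :\ u| = 3.
Proof. by have := cardsD1 u (block u); rewrite card_block block_refl; clear; lia. Qed.

Lemma disjoint_K4_uniform : uniform 3 disjoint_K4.
Proof. by apply/forall_inP => _ /imsetP[u _ ->]; rewrite card_blockD1. Qed.

Lemma disjoint_K4_degree v : degree disjoint_K4 v = 3.
Proof.
rewrite /degree -(card_blockD1 v) -(card_imset _ blockD1_inj); apply: eq_card => T.
rewrite inE; apply/andP/imsetP => [[/imsetP[u _ ->] /setD1P[vu vb]]|[u /setD1P[uv ub] ->]].
  by exists u => //; apply/setD1P; rewrite eq_sym block_sym.
by split; [apply: imset_f|apply/setD1P; rewrite eq_sym block_sym].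
Qed.

Lemma disjoint_K4_regular : regular disjoint_K4.
Proof. by apply/forallP => v; apply/forallP => w; rewrite !disjoint_K4_degree. Qed.

Lemma disjoint_K4_hypergraph : is_hypergraph disjoint_K4.
Proof.
apply/and3P; split.
- by rewrite card_ord n4k muln_gt0.
- by apply/imsetP => -[u _ eq0]; have := card_blockD1 u; rewrite -eq0 cards0.
rewrite -subTset; apply/subsetP => v _; have : 0 < degree disjoint_K4 v by rewrite disjoint_K4_degree.
by case/card_gt0P => T; rewrite inE => /andP[TE vT]; apply/bigcupP; exists T.
Qed.

(** An edge covering [v] omits another vertex of the same block. Hence one edge never covers a
    block, and the cover uses at least two edges in each. *)
Lemma disjoint_K4_rho : 2 * k <= rho disjoint_K4.
Proof.
have [C /andP[CE /eqP covC] ->] := rho_attained (hypergraph_edge_cover disjoint_K4_hypergraph).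
pose U := [set u | block u :\ u \in C].
have UC : #|U| <= #|C|.
  rewrite -(card_imset _ blockD1_inj); apply: subset_leq_card.
  by apply/subsetP => _ /imsetP[u uU ->]; rewrite inE in uU.
apply: leq_trans UC.
have other v : exists2 u, u \in U & (u != v) && (u \in block v).
  have : v \in cover C by rewrite covC inE.
  case/bigcupP => T TC vT; have /imsetP[u _ eT] := subsetP CE T TC.
  exists u; first by rewrite inE -eT.
  by move: vT; rewrite eT => /setD1P[vu vb]; rewrite eq_sym vu block_sym.
have ltq (u : 'I_n) : u %/ 4 < k by rewrite ltn_divLR // mulnC -n4k.
pose q u := Ordinal (ltq u).
rewrite -sum1_card (partition_big q predT) //= mulnC -{1}(card_ord k) -sum_nat_const.
apply: leq_sum => j _; rewrite sum1_card.
have lt4j : 4 * j < n by rewrite n4k ltn_pmul2l.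
(* An edge covering the first vertex of block [j] omits some [u]; an edge covering [u] omits some
   [w] other than [u]. *)
have [u uU /andP[_ ub]] := other (Ordinal lt4j).
have [w wU /andP[wu wb]] := other u.
have qj (x : 'I_n) : x \in block (Ordinal lt4j) -> q x == j.
  by rewrite inE /= => /eqP eqx; apply/eqP/val_inj; rewrite /= eqx mulKn.
rewrite -(_ : #|[set w; u]| = 2); last by rewrite cards2 wu.
apply/subset_leq_card/subsetP => x; rewrite !inE => /orP[]/eqP-> ; rewrite unfold_in.
  by move: wU; rewrite inE => ->; apply: qj; rewrite -(block_eq ub).
by move: uU; rewrite inE => ->; apply: qj.
Qed.

End DisjointK4.

(** * The limit superior *)

From mathcomp Require Import lra.
From mathcomp Require Import all_classical all_reals all_analysis.

Local Open Scope ring_scope.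

(** * The fractional edge cover number *)

Section RhoStar.
Variables (R : realType) (V : finType) (E : {set {set V}}).
Hypotheses (hE : is_hypergraph E) (uniE : uniform 3 E) (regE : regular E).

Lemma sum_incidences (f : {set V} -> R) :
  \sum_(v : V) \sum_(T in E | v \in T) f T = 3 * \sum_(T in E) f T.
Proof.
rewrite (exchange_big_dep (mem E)) /=; last by move=> v T _ /andP[].
rewrite mulr_sumr; apply: eq_bigr => T TE.
have /forall_inP/(_ T TE)/eqP cT := uniE.
rewrite (eq_bigl (mem T)) => [|v]; last by rewrite TE.
by rewrite sumr_const cT mulr_natl.
Qed.

Lemma rho_star_regular : rho_star R E = #|V|%:R / 3.
Proof.
have [d d0 degd] := regularP hE regE.
have d0R : (d%:R : R) != 0 by rewrite pnatr_eq0 -lt0n.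
have lb (f : {set V} -> R) : fractional_edge_cover E f -> #|V|%:R / 3 <= \sum_(T in E) f T.
  move=> [_ f1]; rewrite ler_pdivrMr // mulrC -sum_incidences -sum1_card natr_sum.
  by apply: ler_sum => v _; exact: f1.
pose f0 (T : {set V}) : R := d%:R^-1.
have sum0 v : \sum_(T in E | v \in T) f0 T = 1.
  transitivity (\sum_(T in [set T in E | v \in T]%SET) d%:R^-1 : R).
    by apply: eq_bigl => T; rewrite inE.
  by rewrite sumr_const -/(degree E v) degd -[LHS]mulr_natr mulVf.
have frac0 : fractional_edge_cover E f0.
  by split=> [T _|v]; [rewrite invr_ge0|rewrite sum0].
have eq0 : \sum_(T in E) f0 T = #|V|%:R / 3.
  have := sum_incidences f0; rewrite (eq_bigr _ (fun v _ => sum0 v)) sumr_const.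
  by move=> eqV; apply: (canRL (mulfK _)) => //; rewrite mulrC -eqV.
rewrite /rho_star; apply/eqP; rewrite eq_le; apply/andP; split.
  rewrite -eq0; apply: ge_inf; last by exists f0.
  by exists (#|V|%:R / 3) => _ [f /lb ? <-].
apply: lb_le_inf; first by exists (\sum_(T in E) f0 T), f0.
by move=> _ [f /lb ? <-].
Qed.

Lemma ratio_regular : (rho E)%:R / rho_star R E = 3 * (rho E)%:R / #|V|%:R.
Proof. by rewrite rho_star_regular invf_div mulrA [_ * 3]mulrC. Qed.

End RhoStar.

Lemma max_cover_ratio_le (R : realType) (n : nat) :
  (max_cover_ratio R n <= (3 / 2 : R)%:E)%E.
Proof.
rewrite /max_cover_ratio; apply: (big_ind (fun x => (x <= (3 / 2 : R)%:E)%E)) => [|x y hx hy|E /and3P[hE uE rE]].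
- exact: leNye.
- by rewrite ge_max hx hy.
rewrite lee_fin ratio_regular // card_ord.
have n0 : (0 < n)%N by case/and3P: hE; rewrite card_ord.
have := double_rho_le hE uE rE; rewrite card_ord -(ler_nat R) natrM => le2.
by rewrite ler_pdivrMr ?ltr0n //; lra.
Qed.

Lemma max_cover_ratio_ge (R : realType) (k : nat) :
  (0 < k)%N -> ((3 / 2 : R)%:E <= max_cover_ratio R (4 * k))%E.
Proof.
move=> k0; have e4 : (4 * k = 4 * k)%N by [].
have hE := disjoint_K4_hypergraph k0 e4; have uE := disjoint_K4_uniform e4.
have rE := disjoint_K4_regular e4.
apply: (@le_trans _ _ ((rho (disjoint_K4 (4 * k)))%:R / rho_star R (disjoint_K4 (4 * k)))%:E).
  rewrite lee_fin ratio_regular // card_ord.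
  have := disjoint_K4_rho k0 e4; rewrite -(ler_nat R) natrM => le2.
  have k0R : (0 : R) < k%:R by rewrite ltr0n.
  by rewrite natrM ler_pdivlMr ?mulr_gt0 //; lra.
rewrite /max_cover_ratio (bigD1 (disjoint_K4 (4 * k))) /=; last by rewrite hE uE rE.
by rewrite le_max lexx.
Qed.

Theorem mainTheorem4 (R : realType) :
  limn_esup (max_cover_ratio R) = (3 / 2 : R)%:E.
Proof.
apply/eqP; rewrite eq_le; apply/andP; split.
  (* The upper bound holds for every [n], so the supremum over the whole sequence is already small
     enough. *)
  apply: ge_ereal_inf; exists (ereal_sup [set max_cover_ratio R n | n in setT]%classic).
    by exists setT => //; exact: filterT.
  by apply/ereal_supP => _ [n _ <-]; exact: max_cover_ratio_le.
(* Every tail contains a multiple of 4, at which the ratio reaches 3/2. *)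
apply/ereal_infP => _ [U [N _ NU] <-].
apply: le_ereal_sup_tmp; exists (max_cover_ratio R (4 * N.+1)); last exact: max_cover_ratio_ge.
by exists (4 * N.+1)%N => //; apply: NU => /=; lia.
Qed.
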